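(* Let $\mathcal{R}$ be a voting rule for which the possible winner problem is $\mathrm{NP}$-hard. Then, unless $\mathrm{P}=\mathrm{NP}$, for no factor $K$ does there exist a polynomial-time $K$-approximation algorithm for $\mathcal{R}$-swap-bribery.
   Context: An election is a pair $(C,V)$ with $C$ a finite set of candidates and $V=(v^1,\dots,v^n)$ a list of voters, each voter $v^i$ being a strict linear order $\succ^i$ over $C$. A voting rule $\mathcal{R}$ maps each election to a set of winners $W\subseteq C$ (ties allowed; ''$p$ is a winner'' means $p\in W$). Possible winner problem for $\mathcal{R}$: given a set $C$ of candidates, a list of (strict) partial orders over $C$, and $p\in C$, decide whether each of the partial orders can be extended to a linear order so that $p$ is an $\mathcal{R}$-winner of the resulting election. $\mathcal{R}$-swap-bribery: given an election $(C,V)$, a designated candidate $p\in C$, and for each voter $v^i$ a swap-cost function $\pi^i$ assigning to each unordered pair of distinct candidates a nonnegative integer (the cost of swapping these two candidates in the $i$-th vote when they are adjacent in it), one can perform in each vote any sequence of swaps of adjacent candidates, paying the cost of each swap. Thus the minimum cost of changing $\succ^i$ into a linear order $\succ$ is the sum of $\pi^i(\{a,b\})$ over all pairs $\{a,b\}$ ordered differently by $\succ^i$ and $\succ$. The goal is to make $p$ an $\mathcal{R}$-winner at minimum total cost. A $K$-approximation algorithm, where $K$ is a positive real number, outputs swaps that make $p$ a winner and whose total cost is at most $K$ times the minimum possible total cost (in particular, cost $0$ if the minimum is $0$). *)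

(* Defs.v *)
From HB Require Import structures.
From Stdlib Require Import BinNums.
From mathcomp Require Import all_boot all_order all_algebra finmap reals.

Set Implicit Arguments.
Unset Strict Implicit.
Unset Printing Implicit Defensive.

Import Order.TTheory GRing.Theory Num.Theory.

Local Open Scope fset_scope.

(** * Turing machines and polynomial time *)

(* Deterministic multitape Turing machines. The tape alphabet is fixed to
   {0, 1, blank}, which changes running times only by a constant factor.
   The tapes are indexed by an arbitrary finite type [tm_tape]. *)

Definition cell := option bool. (* None is the blank *)

Variant direction := MoveLeft | MoveRight | Stay.

(* A two-way infinite tape. [tape_left] lists the cells to the left of the
   head, nearest first, [tape_right] those to its right; all cells beyond the
   two lists are blank. *)
Record tape :=
  Tape { tape_left : seq cell; tape_head : cell; tape_right : seq cell }.

Definition tape_act (t : tape) (a : cell * direction) : tape :=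
  let: Tape l _ r := t in
  match a.2 with
  | MoveLeft => Tape (behead l) (head None l) (a.1 :: r)
  | MoveRight => Tape (a.1 :: l) (head None r) (behead r)
  | Stay => Tape l a.1 r
  end.

Record TM := MkTM {
  tm_state : finType;
  tm_tape : finType;
  tm_start : tm_state;
  tm_halted : pred tm_state;
  tm_in : tm_tape;
  tm_out : tm_tape;
  tm_delta : tm_state -> {ffun tm_tape -> cell} ->
             tm_state * {ffun tm_tape -> cell * direction} }.

Section Run.
Variable M : TM.

Definition config := (tm_state M * {ffun tm_tape M -> tape})%type.

Definition tm_step (c : config) : config :=
  let: (q, ts) := c in
  if tm_halted q then c else
  let: (q', act) := tm_delta q [ffun i => tape_head (ts i)] in
  (q', [ffun i => tape_act (ts i) (act i)]).

Definition input_tape (x : seq bool) : tape :=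
  let s := map Some x in Tape [::] (head None s) (behead s).

Definition tm_init (x : seq bool) : config :=
  (tm_start M,
   [ffun i => if i == tm_in M then input_tape x else Tape [::] None [::]]).

Definition tm_run (x : seq bool) (t : nat) : config := iter t tm_step (tm_init x).

Fixpoint read_cells (s : seq cell) : seq bool :=
  if s is Some b :: s' then b :: read_cells s' else [::].

(* The output of a halted machine: the bits on the output tape from the head
   rightwards up to the first blank. *)
Definition tm_outputs (x : seq bool) (t : nat) (y : seq bool) : Prop :=
  let: (q, ts) := tm_run x t in
  let o := ts (tm_out M) in
  tm_halted q /\ read_cells (tape_head o :: tape_right o) = y.

End Run.

(* On every instance [a : A] satisfying [D], presented to [M] as the string
   [enc a], [M] halts within a number of steps polynomial in the length of that
   string, with an output allowed by [spec a]. Nothing is required of [M] on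
   other strings. *)
Definition polytime_solves (A : Type) (D : A -> Prop) (enc : A -> seq bool)
    (spec : A -> seq bool -> Prop) (M : TM) : Prop :=
  exists p : {poly nat}, forall a : A, D a ->
    exists (t : nat) (y : seq bool),
      [/\ (t <= (p.[size (enc a)])%R)%N, tm_outputs M (enc a) t y & spec a y].

Definition polytime (f : seq bool -> seq bool) : Prop :=
  exists M : TM, polytime_solves (fun _ => True) id (fun x y => y = f x) M.

(** * Encodings as bit strings *)

(* All encodings below are self-delimiting, so pairs are encoded by
   concatenation. *)

Definition enc_seq (A : Type) (enc : A -> seq bool) (s : seq A) : seq bool :=
  flatten [seq true :: enc x | x <- s] ++ [:: false].

Definition enc_pair (A B : Type) (encA : A -> seq bool) (encB : B -> seq bool)
    (x : A * B) : seq bool := encA x.1 ++ encB x.2.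

Definition enc_option (A : Type) (enc : A -> seq bool) (o : option A) : seq bool :=
  if o is Some x then true :: enc x else [:: false].

Definition enc_string : seq bool -> seq bool := enc_seq (fun b => [:: b]).

(* Binary numerals, least significant bit first. *)
Fixpoint pos_bits (n : positive) : seq bool :=
  match n with
  | xI n' => true :: pos_bits n'
  | xO n' => false :: pos_bits n'
  | xH => [:: true]
  end.

Definition nat_bits (n : nat) : seq bool :=
  if bin_of_nat n is Npos k then pos_bits k else [::].

Definition enc_nat (n : nat) : seq bool := enc_string (nat_bits n).

(** * P, NP and NP-hardness *)

Definition language := seq bool -> Prop.

Definition inP (L : language) : Prop :=
  exists f : seq bool -> bool,
    polytime (fun x => [:: f x]) /\ (forall x, L x <-> f x).

Definition inNP (L : language) : Prop :=
  exists (V : language) (q : {poly nat}), inP V /\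
    forall x, L x <->
      exists w : seq bool,
        (size w <= (q.[size x])%R)%N /\ V (enc_pair enc_string enc_string (x, w)).

Definition P_eq_NP : Prop := forall L : language, inP L <-> inNP L.

Definition karp_reducible (L L' : language) : Prop :=
  exists f : seq bool -> seq bool, polytime f /\ (forall x, L x <-> L' (f x)).

Definition NP_hard (L : language) : Prop :=
  forall L' : language, inNP L' -> karp_reducible L' L.

(** * Orders and elections *)

(* Candidates are named by natural numbers. An order over a set of candidates
   is a set of pairs; [(a, b) \in r] means that [a] is preferred to [b]. *)
Definition order := {fset nat * nat}.

Definition strict_partial_order (C : {fset nat}) (r : order) : Prop :=
  [/\ r `<=` C `*` C,
      forall a, (a, a) \notin r &
      forall a b c, (a, b) \in r -> (b, c) \in r -> (a, c) \in r].

Definition strict_linear_order (C : {fset nat}) (r : order) : Prop :=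
  strict_partial_order C r /\
  {in C &, forall a b, a != b -> ((a, b) \in r) || ((b, a) \in r)}.

Record election := Election { cands : {fset nat}; voters : seq order }.

Definition election_wf (E : election) : Prop :=
  {in voters E, forall v, strict_linear_order (cands E) v}.

(* The value of a rule on ill-formed data is irrelevant: it is only ever
   consulted on well-formed elections. *)
Record voting_rule := VotingRule {
  winners :> election -> {fset nat};
  winners_sub : forall E, election_wf E -> winners E `<=` cands E }.

Definition enc_cands (C : {fset nat}) : seq bool :=
  enc_seq enc_nat (sort leq (enum_fset C)).

(* An order is encoded as the list of its pairs, in lexicographic order. *)
Definition enc_order (C : {fset nat}) (r : order) : seq bool :=
  let s := sort leq (enum_fset C) in
  enc_seq (enc_pair enc_nat enc_nat)
    [seq e <- [seq (a, b) | a <- s, b <- s] | e \in r].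

(** * Possible winner *)

Record pw_instance := PWInstance {
  pw_cands : {fset nat};
  pw_orders : seq order;
  pw_cand : nat }.

Definition pw_wf (I : pw_instance) : Prop :=
  {in pw_orders I, forall r, strict_partial_order (pw_cands I) r} /\
  pw_cand I \in pw_cands I.

Definition enc_pw (I : pw_instance) : seq bool :=
  enc_cands (pw_cands I) ++
  enc_seq (enc_order (pw_cands I)) (pw_orders I) ++
  enc_nat (pw_cand I).

Definition is_possible_winner (R : voting_rule) (I : pw_instance) : Prop :=
  exists V : seq order,
    [/\ size V = size (pw_orders I),
        forall i, (i < size V)%N ->
          strict_linear_order (pw_cands I) (nth fset0 V i) /\
          nth fset0 (pw_orders I) i `<=` nth fset0 V i &
        pw_cand I \in R (Election (pw_cands I) V)].

Definition possible_winner (R : voting_rule) : language := fun x =>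
  exists I : pw_instance, [/\ pw_wf I, x = enc_pw I & is_possible_winner R I].

(** * Swap bribery *)

(* Only the costs of two-element subsets of the candidate set matter. *)
Definition swap_cost := {fset nat} -> nat.

(* The i-th entry of [sb_costs] is the cost function of the i-th voter. *)
Record sb_instance := SBInstance {
  sb_election : election;
  sb_costs : seq swap_cost;
  sb_cand : nat }.

Definition sb_wf (I : sb_instance) : Prop :=
  [/\ election_wf (sb_election I),
      size (sb_costs I) = size (voters (sb_election I)) &
      sb_cand I \in cands (sb_election I)].

(* The table of the costs of all pairs {a, b} with a < b in C. *)
Definition enc_cost (C : {fset nat}) (pi : swap_cost) : seq bool :=
  let s := sort leq (enum_fset C) in
  enc_seq (enc_pair (enc_pair enc_nat enc_nat) enc_nat)
    [seq (e, pi [fset e.1; e.2]) | e <- [seq (a, b) | a <- s, b <- s] & (e.1 < e.2)%N].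

Definition enc_sb (I : sb_instance) : seq bool :=
  let C := cands (sb_election I) in
  enc_cands C ++
  enc_seq (enc_order C) (voters (sb_election I)) ++
  enc_seq (enc_cost C) (sb_costs I) ++
  enc_nat (sb_cand I).

(* The swap [(a, b)] exchanges [a] and the candidate [b] directly below it. *)
Definition swap := (nat * nat)%type.

Definition swap_allowed (v : order) (s : swap) : Prop :=
  s \in v /\ ~ (exists c, (s.1, c) \in v /\ (c, s.2) \in v).

Definition do_swap (v : order) (s : swap) : order := (s.2, s.1) |` (v `\ s).

Definition do_swaps (v : order) (ss : seq swap) : order := foldl do_swap v ss.

Fixpoint swaps_allowed (v : order) (ss : seq swap) : Prop :=
  if ss is s :: ss' then swap_allowed v s /\ swaps_allowed (do_swap v s) ss'
  else True.

Definition swaps_cost (pi : swap_cost) (ss : seq swap) : nat :=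
  \sum_(s <- ss) pi [fset s.1; s.2].

(* A bribery lists, for each voter, the swaps performed in their vote. *)
Definition bribery := seq (seq swap).

Definition bribed (E : election) (B : bribery) : election :=
  Election (cands E) [seq do_swaps e.1 e.2 | e <- zip (voters E) B].

Definition successful (R : voting_rule) (I : sb_instance) (B : bribery) : Prop :=
  let V := voters (sb_election I) in
  [/\ size B = size V,
      forall i, (i < size V)%N -> swaps_allowed (nth fset0 V i) (nth [::] B i) &
      sb_cand I \in R (bribed (sb_election I) B)].

Definition total_cost (I : sb_instance) (B : bribery) : nat :=
  \sum_(e <- zip (sb_costs I) B) swaps_cost e.1 e.2.

Definition min_total_cost (R : voting_rule) (I : sb_instance) (m : nat) : Prop :=
  (exists2 B, successful R I B & total_cost I B = m) /\
  (forall B, successful R I B -> (m <= total_cost I B)%N).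

(* The answer [None] reports that no bribery makes the designated candidate a
   winner. Without it, an approximation algorithm could only exist for rules
   all of whose instances are solvable. *)
Definition approximate_answer (T : realType) (K : T) (R : voting_rule)
    (I : sb_instance) (ans : option bribery) : Prop :=
  match ans with
  | Some B => successful R I B /\
      exists2 m, min_total_cost R I m &
        ((total_cost I B)%:R <= K * m%:R)%R
  | None => ~ exists B, successful R I B
  end.

Definition enc_answer : option bribery -> seq bool :=
  enc_option (enc_seq (enc_seq (enc_pair enc_nat enc_nat))).

Definition polytime_approximation (T : realType) (K : T) (R : voting_rule)
    (M : TM) : Prop :=
  polytime_solves sb_wf enc_sb
    (fun I y => exists2 ans, y = enc_answer ans & approximate_answer K R I ans) M.

(* Main.v *)
Require Import Defs.
From Stdlib Require Import BinNums.
From mathcomp Require Import all_boot all_order all_algebra finmap boolp reals.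
From mathcomp Require Import zify.

Set Implicit Arguments.
Unset Strict Implicit.
Unset Printing Implicit Defensive.

Import Order.TTheory GRing.Theory Num.Theory.

(* A possible winner instance becomes a swap bribery instance by extending every
   partial order [r] to a linear order and charging 1 for swapping a pair that is
   comparable in [r] and 0 for any other swap. Bubble sort leads from one linear
   extension of [r] to any other one without touching a pair of [r], whereas a
   swap sequence of cost 0 never leaves the linear extensions of [r]. Hence the
   optimum is 0 exactly on the positive instances, and any K-approximation has to
   return a bribery of cost 0 on these. Recomputing that cost decides the possible
   winner problem, hence everything in NP, in polynomial time.

   The machines come from a stack language: a function is implemented by a program
   that replaces the code of its argument on top of a stack by the code of its
   value and leaves everything below and all other stacks as they were. Such
   programs compose without renaming registers or clearing work space. Only the
   given machines (of the Karp reduction and of the approximation algorithm) run on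
   tapes of their own. *)

(** * Structured programs for Turing machines *)

(** Two features of the model shape the proof. The approximation machine is promised to behave only
    on encodings of well-formed instances, whereas a decision procedure must answer on every string;
    strings are therefore parsed, validated by encoding the result again, and replaced by a fixed
    instance if they fail. Moreover, its answer is tied to the instance by a relation only, and on
    negative instances both [None] and bribery of positive cost can be legitimate. The verdict thus
    comes from inspecting the returned swaps, for which the instance has to be carried past the
    machine. The factor is harmless because [K * 0 = 0]. Programs act on binary trees in preorder
    notation. This code delimits itself, so a program finds the end of its argument without knowing
    what lies beneath it. The obstacle with loops is size rather than the number of rounds:
    polynomially many rounds of polynomial growth may produce exponentially large data. This is why
    size bounds accompany time bounds throughout, and why the parsers, whose output feeds their own
    loop, need a potential argument. *)

Section Flow.
Variable I : finType.

Definition tapes := {ffun I -> tape}.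

(* A Turing machine fragment; the label [None] means that control leaves it. *)
Record flow := Flow {
  lab : finType;
  entry : lab;
  trans : lab -> {ffun I -> cell} -> option lab * {ffun I -> cell * direction} }.

Definition heads (ts : tapes) : {ffun I -> cell} := [ffun i => tape_head (ts i)].
Definition acts (ts : tapes) (a : {ffun I -> cell * direction}) : tapes :=
  [ffun i => tape_act (ts i) (a i)].
Definition idle (h : {ffun I -> cell}) : {ffun I -> cell * direction} :=
  [ffun i => (h i, Stay)].

Lemma acts_idle ts : acts ts (idle (heads ts)) = ts.
Proof. by apply/ffunP=> i; rewrite !ffunE /=; case: (ts i). Qed.

Definition fstep (p : flow) (c : option (lab p) * tapes) : option (lab p) * tapes :=
  if c.1 is Some l then
    let: (o, a) := trans l (heads c.2) in (o, acts c.2 a)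
  else c.

Definition exec (p : flow) (ts : tapes) (n : nat) (ts' : tapes) : Prop :=
  iter n (@fstep p) (Some (entry p), ts) = (None, ts').

Lemma iter_fstep_None p n ts : iter n (@fstep p) (None, ts) = (None, ts).
Proof. by elim: n => //= n ->. Qed.

(** The label [None] is absorbing, so the count in [exec] is an upper bound on the running time and
    may be rounded up freely. *)
Lemma exec_mono p ts n m ts' : exec p ts n ts' -> n <= m -> exec p ts m ts'.
Proof.
move=> H le_nm; rewrite /exec -(subnK le_nm) iterD H.
exact: iter_fstep_None.
Qed.

Definition Do (i : I) (w : option cell) (d : direction) : flow :=
  @Flow unit tt (fun _ h =>
    (None, [ffun j => if j == i then (odflt (h j) w, d) else (h j, Stay)])).

Definition upd (ts : tapes) (i : I) (t : tape) : tapes :=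
  [ffun j => if j == i then t else ts j].

Lemma exec_Do i w d ts :
  exec (Do i w d) ts 1
    (upd ts i (tape_act (ts i) (odflt (tape_head (ts i)) w, d))).
Proof.
rewrite /exec /= /fstep /=; congr (_, _); apply/ffunP=> j; rewrite !ffunE.
by case: eqP => [->|_] //=; case: (ts j).
Qed.

(* [embed] maps the labels of a subprogram [p] to labels of [r]; leaving [p]
   leads to [out]. *)
Lemma simul (p r : flow) (embed : lab p -> lab r) (out : option (lab r)) :
  (forall l h, trans (embed l) h =
     ((if (trans l h).1 is Some l' then Some (embed l') else out), (trans l h).2)) ->
  forall n l ts ts', iter n (@fstep p) (Some l, ts) = (None, ts') ->
  exists2 n', n' <= n & iter n' (@fstep r) (Some (embed l), ts) = (out, ts').
Proof.
move=> Htr; elim=> [|n IHn] l ts ts' //; rewrite iterSr /fstep /=.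
case E: (trans l (heads ts)) => [[l'|] a] H.
  have [n' le_n' H'] := IHn _ _ _ H; exists n'.+1 => //.
  by rewrite iterSr /fstep /= Htr E.
move: H; rewrite iter_fstep_None => -[<-]; exists 1 => //.
by rewrite /= /fstep /= Htr E.
Qed.

Definition Seq (p q : flow) : flow :=
  @Flow (lab p + lab q)%type (inl (entry p)) (fun l h =>
    match l with
    | inl l => let: (o, a) := trans l h in
               (Some (if o is Some l' then inl l' else inr (entry q)), a)
    | inr l => let: (o, a) := trans l h in (omap inr o, a)
    end).

Lemma exec_Seq p q ts n ts1 m ts2 :
  exec p ts n ts1 -> exec q ts1 m ts2 -> exec (Seq p q) ts (n + m) ts2.
Proof.
move=> Hp Hq.
have [|n' le_n' Hn'] := @simul p (Seq p q) inl (Some (inr (entry q))) _ _ _ _ _ Hp.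
  by move=> l h /=; case: (trans l h) => [[l'|] a].
have [|m' le_m' Hm'] := @simul q (Seq p q) inr None _ _ _ _ _ Hq.
  by move=> l h /=; case: (trans l h) => [[l'|] a].
apply: (@exec_mono _ _ (m' + n')); last by rewrite addnC leq_add.
by rewrite /exec iterD Hn' Hm'.
Qed.

Definition If (c : cell -> bool) (i : I) (p q : flow) : flow :=
  @Flow (option (lab p + lab q)) None (fun l h =>
    match l with
    | None => (Some (Some (if c (h i) then inl (entry p) else inr (entry q))), idle h)
    | Some (inl l) => let: (o, a) := trans l h in (omap (Some \o inl) o, a)
    | Some (inr l) => let: (o, a) := trans l h in (omap (Some \o inr) o, a)
    end).

Lemma exec_If c i p q (ts : tapes) n ts' :
  exec (if c (tape_head (ts i)) then p else q) ts n ts' ->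
  exec (If c i p q) ts n.+1 ts'.
Proof.
move=> H.
have [n' le_n' Hn'] : exists2 n', n' <= n &
    iter n' (@fstep (If c i p q))
      (Some (Some (if c (tape_head (ts i)) then inl (entry p) else inr (entry q))), ts)
    = (None, ts').
  case: ifP H => _ H.
    have [|n' ? ?] := @simul p (If c i p q) (Some \o inl) None _ _ _ _ _ H.
      by move=> l h /=; case: (trans l h) => [[l'|] a].
    by exists n'.
  have [|n' ? ?] := @simul q (If c i p q) (Some \o inr) None _ _ _ _ _ H.
    by move=> l h /=; case: (trans l h) => [[l'|] a].
  by exists n'.
apply: (@exec_mono _ _ n'.+1) => //.
by rewrite /exec iterSr /fstep /= acts_idle ffunE.
Qed.

Definition While (c : cell -> bool) (i : I) (p : flow) : flow :=
  @Flow (option (lab p)) None (fun l h =>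
    match l with
    | None => (if c (h i) then Some (Some (entry p)) else None, idle h)
    | Some l => let: (o, a) := trans l h in (Some o, a)
    end).

Lemma exec_While_stop (c : cell -> bool) i p (ts : tapes) :
  ~~ c (tape_head (ts i)) -> exec (While c i p) ts 1 ts.
Proof. by move=> /negPf H; rewrite /exec /= /fstep /= acts_idle ffunE H. Qed.

Lemma exec_While_step (c : cell -> bool) i p (ts : tapes) n ts1 m ts2 :
  c (tape_head (ts i)) -> exec p ts n ts1 -> exec (While c i p) ts1 m ts2 ->
  exec (While c i p) ts (n + m).+1 ts2.
Proof.
move=> Hc Hp Hw.
have [|n' le_n' Hn'] := @simul p (While c i p) Some (Some None) _ _ _ _ _ Hp.
  by move=> l h /=; case: (trans l h) => [[l'|] a].
apply: (@exec_mono _ _ (m + n').+1); last by rewrite ltnS addnC leq_add2r.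
have E : @fstep (While c i p) (Some None, ts) = (Some (Some (entry p)), ts).
  by rewrite /fstep /= acts_idle ffunE Hc.
by rewrite /exec iterSr E iterD Hn'.
Qed.

Definition Call (M : TM) (e : tm_tape M -> I) : flow :=
  @Flow (tm_state M) (tm_start M) (fun q h =>
    if tm_halted q then (None, idle h) else
    let: (q', act) := tm_delta q [ffun j => h (e j)] in
    (Some q', [ffun i => if [pick j | e j == i] is Some j then act j else (h i, Stay)])).

(** The machine may halt before step [t]: a halted configuration is a fixed point of [tm_step],
    while the fragment leaves at once. Noticing the halting state costs the additional step in
    [t.+1]. Injectivity of [e] makes the [pick] in [Call] its inverse. *)
Lemma exec_Call (M : TM) (e : tm_tape M -> I) : injective e ->
  forall t q (ts : tapes) q' ts1,
  iter t (@tm_step M) (q, [ffun j => ts (e j)]) = (q', ts1) -> tm_halted q' ->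
  exists ts', [/\ iter t.+1 (@fstep (Call e)) (Some q, ts) = (None, ts'),
    forall j, ts' (e j) = ts1 j &
    forall i, (forall j, e j != i) -> ts' i = ts i].
Proof.
move=> e_inj; elim=> [|t IHt] q ts q' ts1.
  move=> [-> <-] hq'; exists ts; split=> // [|j]; last by rewrite ffunE.
  by rewrite /= /fstep /= hq' acts_idle.
rewrite iterSr {2}/tm_step; case: (boolP (tm_halted q)) => [hq|nhq].
  move=> H hq'; have [ts' [H1 H2 H3]] := IHt _ _ _ _ H hq'.
  by exists ts'; split=> //; rewrite iterS H1.
case E: (tm_delta q _) => [q1 act] H hq'.
pose ts2 : tapes := acts ts
  [ffun i => if [pick j | e j == i] is Some j then act j else (heads ts i, Stay)].
have pickE j : [pick j' | e j' == e j] = Some j.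
  by case: pickP => [j' /eqP/e_inj -> //|/(_ j)]; rewrite eqxx.
have ts2E : [ffun j => ts2 (e j)] =
    [ffun i => tape_act ([ffun j => ts (e j)] i) (act i)].
  by apply/ffunP=> j; rewrite !ffunE pickE.
rewrite -ts2E in H.
have [ts' [H1 H2 H3]] := IHt _ _ _ _ H hq'.
exists ts'; split=> //.
  have -> : iter t.+2 (@fstep (Call e)) (Some q, ts) = iter t.+1 (@fstep (Call e)) (Some q1, ts2).
    rewrite iterSr; congr iter; rewrite /fstep /= (negPf nhq).
    suff -> : [ffun j => heads ts (e j)] =
        [ffun i => tape_head ([ffun j => ts (e j)] i)] by rewrite E.
    by apply/ffunP=> j; rewrite !ffunE.
  exact: H1.
move=> i Hi; rewrite H3 // !ffunE; case: pickP => [j|_] /=.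
  by rewrite (negPf (Hi j)).
by case: (ts i).
Qed.

Definition flow_TM (p : flow) (i o : I) : TM :=
  @MkTM (option (lab p)) I (Some (entry p)) (fun q => ~~ isSome q) i o
    (fun q h => if q is Some l then trans l h else (None, idle h)).

Definition init (i : I) (x : seq bool) : tapes :=
  [ffun j => if j == i then input_tape x else Tape [::] None [::]].

(* A tape serves as a stack with its top under the head: popping moves right, pushing
   moves left, so cells left of the head and right of the first blank are irrelevant. *)
Definition bits (t : tape) : seq bool := read_cells (tape_head t :: tape_right t).

Lemma flow_TM_outputs (p : flow) i o x n ts' :
  exec p (init i x) n ts' -> tm_outputs (flow_TM p i o) x n (bits (ts' o)).
Proof.
move=> H; rewrite /tm_outputs /tm_run.
have stepE c : @tm_step (flow_TM p i o) c = @fstep p c.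
  by case: c => l ts; case: l.
by rewrite (eq_iter stepE) /tm_init /= -/(init i x) H.
Qed.

End Flow.

(** * Polynomial bounds and composition of machines *)

(** Since the base is at least 2, one more factor absorbs the doubling in a sum and a large exponent
    absorbs any constant. A polynomial bound is thus described by a single exponent. *)
Definition bnd (k n : nat) : nat := n.+2 ^ k.

Lemma bnd_mono k m n : m <= n -> bnd k m <= bnd k n.
Proof. by move=> H; rewrite /bnd; case: k => // k; rewrite leq_exp2r. Qed.

Lemma bnd_le k l n : k <= l -> bnd k n <= bnd l n.
Proof. by move=> H; apply: leq_pexp2l. Qed.

Definition PB (f : nat -> nat) : Prop := exists k, forall n, f n <= bnd k n.

Lemma PB_bnd k : PB (bnd k).
Proof. by exists k. Qed.

Lemma PB_le f g : (forall n, f n <= g n) -> PB g -> PB f.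
Proof. by move=> H [k Hk]; exists k => n; apply: leq_trans (H n) (Hk n). Qed.

Lemma PB_const c : PB (fun=> c).
Proof.
exists c => n; apply: leq_trans (ltnW (ltn_expl c (ltnSn 1))) _.
by rewrite /bnd; case: c => // c; rewrite leq_exp2r.
Qed.

Lemma PB_id : PB id.
Proof. by exists 1 => n; rewrite /bnd expn1 !leqW. Qed.

Lemma PB_add f g : PB f -> PB g -> PB (fun n => f n + g n).
Proof.
move=> [k Hk] [l Hl]; exists (k + l).+1 => n.
have H1 : f n <= bnd (k + l) n by apply: leq_trans (Hk n) _; apply: bnd_le; apply: leq_addr.
have H2 : g n <= bnd (k + l) n by apply: leq_trans (Hl n) _; apply: bnd_le; apply: leq_addl.
apply: leq_trans (leq_add H1 H2) _.
by rewrite addnn -mul2n /bnd expnS leq_mul2r ltnS ltnS leq0n orbT.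
Qed.

Lemma PB_mul f g : PB f -> PB g -> PB (fun n => f n * g n).
Proof.
by move=> [k Hk] [l Hl]; exists (k + l) => n; rewrite /bnd expnD leq_mul.
Qed.

Lemma PB_comp f g : PB f -> PB g -> PB (fun n => f (g n)).
Proof.
(* The value [g n + 2] is at most [(n + 2) ^ l + 2], and two further factors of at least 2 absorb
   the summand 2. *)
move=> [k Hk] [l Hl]; exists (l.+2 * k) => n.
apply: leq_trans (Hk _) _; rewrite /bnd expnM; case: k {Hk} => // k.
rewrite leq_exp2r //; have := Hl n; rewrite /bnd !expnS => H.
have : 0 < n.+2 ^ l by rewrite expn_gt0.
by move: (n.+2 ^ l) H => a; nia.
Qed.

Lemma poly_PB (p : {poly nat}) : PB (fun n => (p.[n])%R).
Proof.
elim/poly_ind: p => [|p c IHp]; first by exists 0 => n; rewrite horner0.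
apply: (@PB_le _ (fun n => (p.[n])%R * n + c)).
  by move=> n; rewrite hornerMXaddC; apply: leqnn.
exact: (PB_add (PB_mul IHp PB_id) (PB_const c)).
Qed.

Lemma bnd_poly k : exists p : {poly nat}, forall n, (p.[n])%R = bnd k n.
Proof.
exists (('X + 2%:P) ^+ k)%R => n; rewrite horner_exp hornerD hornerX hornerC.
rewrite /bnd -(addn2 n); elim: k => [|k IHk]; first by rewrite expr0.
rewrite expnS exprS IHk; reflexivity.
Qed.

(** Inputs are indexed by [x], so nothing is claimed on strings outside the range of [inp]. The
    approximation machine fits this form, being specified on encoded instances only. *)
Definition computes_on (M : TM) (X : Type) (inp out : X -> seq bool) : Prop :=
  exists k, forall x,
    exists2 t, t <= bnd k (size (inp x)) & tm_outputs M (inp x) t (out x).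

Lemma polytimeP f : polytime f <-> exists M, computes_on M id f.
Proof.
split=> [[M [p Hp]]|[M [k Hk]]]; exists M.
  have [k Hk] := poly_PB p; exists k => x.
  have [t [y [Ht Hy Ey]]] := Hp x I; exists t; last by rewrite -Ey.
  exact: leq_trans Ht (Hk _).
have [p Hp] := bnd_poly k; exists p => x _; have [t Ht Hy] := Hk x.
by exists t, (f x); rewrite Hp.
Qed.

(** * Tapes up to trailing blanks, and the length of outputs *)

(** The lists of a tape may end in explicit blanks, and a tape filled by pushes carries some where a
    fresh input tape does not. A machine observes tapes only up to this equality of infinite
    sequences of cells. *)
Definition teq (t t' : tape) : Prop :=
  [/\ tape_head t = tape_head t',
      forall n, nth None (tape_left t) n = nth None (tape_left t') n &
      forall n, nth None (tape_right t) n = nth None (tape_right t') n].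

Lemma teq_act t t' a : teq t t' -> teq (tape_act t a) (tape_act t' a).
Proof.
case: t => l h r; case: t' => l' h' r' [/= _ Hl Hr]; case: a => c [] /=.
- split=> [||[|n]] //=; first by rewrite -!nth0 Hl.
  by move=> n; rewrite !nth_behead Hl.
- split=> [|[|n]|] //=; first by rewrite -!nth0 Hr.
  by move=> n; rewrite !nth_behead Hr.
- by [].
Qed.

Lemma read_cells_nth s s' :
  (forall n, nth None s n = nth None s' n) -> read_cells s = read_cells s'.
Proof.
elim: s s' => [|c s IHs] [|c' s'] H //=.
- by have := H 0; rewrite /= => <-.
- by have := H 0; rewrite /= => ->.
have := H 0; rewrite /= => <-; rewrite (IHs s') //.
by move=> n; apply: (H n.+1).
Qed.

Lemma teq_val t t' : teq t t' -> bits t = bits t'.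
Proof. by case=> h _ r; apply: read_cells_nth => -[|n] /=. Qed.

Lemma tm_steps_teq (M : TM) n q (ts ts' : {ffun tm_tape M -> tape}) :
  (forall j, teq (ts j) (ts' j)) ->
  let c := iter n (@tm_step M) (q, ts) in
  let c' := iter n (@tm_step M) (q, ts') in
  c.1 = c'.1 /\ forall j, teq (c.2 j) (c'.2 j).
Proof.
move=> H; elim: n => [|n /=] //=.
case: (iter n _ _) => q1 ts1; case: (iter n _ _) => q2 ts2 /= [<- H12].
case: ifP => // _.
have -> : [ffun i => tape_head (ts2 i)] = [ffun i => tape_head (ts1 i)].
  by apply/ffunP=> i; rewrite !ffunE; case: (H12 i).
case: (tm_delta q1 _) => q' act; split=> // j; rewrite !ffunE; exact: teq_act.
Qed.

Lemma size_tape_act t a : size (tape_right (tape_act t a)) <= (size (tape_right t)).+1.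
Proof.
case: t => l h r; case: a => c [] //=; rewrite size_behead; lia.
Qed.

Lemma size_read_cells s : size (read_cells s) <= size s.
Proof. by elim: s => [|[b|] s IHs]. Qed.

(** A step lengthens the explicit right part of a tape by at most one cell. This bounds the input of
    the second machine in a composition. *)
Lemma size_outputs M x t y : tm_outputs M x t y -> size y <= size x + t + 1.
Proof.
rewrite /tm_outputs /tm_run.
have H j : size (tape_right ((iter t (@tm_step M) (tm_init M x)).2 j)) <= size x + t.
  elim: t => [|t] /=; last first.
    case: (iter t _ _) => q ts /= IH; case: ifP => _ /=.
      by rewrite addnS (leq_trans IH).
    case: tm_delta => q' act; rewrite ffunE addnS.
    exact: leq_trans (size_tape_act _ _) _.
  rewrite addn0 ffunE; case: ifP => //= _.
  by rewrite size_behead size_map leq_pred.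
move: H; case: (iter t _ _) => q ts H [_ <-].
apply: leq_trans (size_read_cells _) _; rewrite addn1 ltnS; exact: H.
Qed.

(** * Tapes as stacks *)

Section Stack.
Variable I : finType.
Implicit Types (ts : tapes I) (i a : I).

Definition tpush (t : tape) (b : bool) : tape :=
  Tape (behead (tape_left t)) (Some b) (tape_head t :: tape_right t).
Definition tpop (t : tape) : tape :=
  Tape (tape_head t :: tape_left t) (head None (tape_right t)) (behead (tape_right t)).

Definition Push i b : flow I := Seq (Do i None MoveLeft) (Do i (Some (Some b)) Stay).
Definition Pop i : flow I := Do i None MoveRight.

Lemma updK ts i t t' : upd (upd ts i t) i t' = upd ts i t'.
Proof. by apply/ffunP=> j; rewrite !ffunE; case: eqP. Qed.

Lemma upd_same ts i t : upd ts i t i = t.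
Proof. by rewrite ffunE eqxx. Qed.

Lemma upd_other ts i t j : j != i -> upd ts i t j = ts j.
Proof. by move=> /negPf H; rewrite ffunE H. Qed.

Lemma exec_Push i b ts : exec (Push i b) ts 2 (upd ts i (tpush (ts i) b)).
Proof.
have := exec_Seq (exec_Do i None MoveLeft ts) (exec_Do i (Some (Some b)) Stay _).
rewrite updK upd_same => H; rewrite /exec -[2]/(1 + 1) H.
by rewrite /tpush; case: (ts i).
Qed.

Lemma exec_Pop i ts : exec (Pop i) ts 1 (upd ts i (tpop (ts i))).
Proof.
by have := exec_Do i None MoveRight ts; rewrite /tpop; case: (ts i).
Qed.

Lemma val_tpush t b : bits (tpush t b) = b :: bits t.
Proof. by []. Qed.

Lemma val_tpop t b s : bits t = b :: s -> bits (tpop t) = s.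
Proof. by case: t => l [c|] [|d r] //= [_ <-]. Qed.

Lemma head_val t : tape_head t = ohead (bits t).
Proof. by case: t => l [c|] r. Qed.

Definition Drain a (body : bool -> flow I) : flow I :=
  While isSome a (If (pred1 (Some true)) a (Seq (Pop a) (body true)) (Seq (Pop a) (body false))).

Lemma exec_Drain a body c (P : seq bool -> tapes I -> Prop) :
  (forall s ts, P s ts -> bits (ts a) = s) ->
  (forall b s ts, P (b :: s) ts ->
     exists2 ts', exec (body b) (upd ts a (tpop (ts a))) c ts' & P s ts') ->
  forall s ts, P s ts ->
  exists2 ts', exec (Drain a body) ts ((c + 3) * size s).+1 ts' & P [::] ts'.
Proof.
move=> Pval Hstep; elim=> [|b s IHs] ts Pts.
  exists ts => //; apply: (exec_mono (n := 1)) => //; apply: exec_While_stop.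
  by rewrite head_val (Pval _ _ Pts).
have [ts1 H1 P1] := Hstep _ _ _ Pts; have [ts2 H2 P2] := IHs _ P1.
exists ts2 => //; have Ha : tape_head (ts a) = Some b by rewrite head_val (Pval _ _ Pts).
apply: (exec_mono (n := ((1 + c).+1 + ((c + 3) * size s).+1).+1)); last first.
  by rewrite /= mulnS; lia.
apply: exec_While_step H2; first by rewrite Ha.
apply: exec_If; rewrite Ha /=.
by case: b H1 {Ha Pts} => H1; apply: exec_Seq (exec_Pop a ts) _.
Qed.

Lemma teq_input_push t w b : teq t (input_tape w) -> teq (tpush t b) (input_tape (b :: w)).
Proof.
move=> [h l r]; split=> //= n.
  by rewrite nth_behead l /= !nth_nil.
by rewrite h /=; case: n => [|n] /=; rewrite ?r ?nth_behead // nth0.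
Qed.

End Stack.

Lemma val_input x : bits (input_tape x) = x.
Proof.
have read_map s : read_cells (map Some s) = s by elim: s => //= b s ->.
by case: x => [|b x] //; rewrite /bits /= read_map.
Qed.

Lemma outputs_run (I : finType) (M : TM) (e : tm_tape M -> I) (ts : tapes I) x t y :
  injective e ->
  (forall j, teq (ts (e j)) (if j == tm_in M then input_tape x else Tape [::] None [::])) ->
  tm_outputs M x t y ->
  exists ts', [/\ exec (Call e) ts t.+1 ts', bits (ts' (e (tm_out M))) = y &
    forall i, (forall j, e j != i) -> ts' i = ts i].
Proof.
move=> e_inj Hts; rewrite /tm_outputs /tm_run.
have Heq j : teq ([ffun j => ts (e j)] j) ((tm_init M x).2 j) by rewrite !ffunE.
have := tm_steps_teq t (tm_start M) Heq; cbv zeta.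
have -> : (tm_start M, (tm_init M x).2) = tm_init M x by [].
case: (iter t _ (tm_init M x)) => q ts1; case E: (iter t _ _) => [q0 ts0] /=.
move=> [<- Hteq] [Hq <-].
have [ts' [H1 H2 H3]] := exec_Call e_inj E Hq.
exists ts'; split=> //; rewrite H2; exact: teq_val (Hteq _).
Qed.

(** * Composition of two machines *)

Section Comp.
Variables (M1 M2 : TM).

Let I := (tm_tape M1 + tm_tape M2 + unit)%type.
Let e1 (j : tm_tape M1) : I := inl (inl j).
Let e2 (j : tm_tape M2) : I := inl (inr j).
Let tmp : I := inr tt.

(** Draining a tape reverses its string, so the output of [M1] goes through [tmp] to arrive in its
    original order on the input tape of [M2], whose tapes are still blank. *)
Definition comp_TM : TM :=
  @flow_TM I (Seq (Seq (Call e1) (Drain (e1 (tm_out M1)) (Push tmp)))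
    (Seq (Drain tmp (Push (e2 (tm_in M2)))) (Call e2))) (e1 (tm_in M1)) (e2 (tm_out M2)).

Lemma comp_TM_outputs x t1 y t2 z :
  tm_outputs M1 x t1 y -> tm_outputs M2 y t2 z ->
  tm_outputs comp_TM x (t1.+1 + (5 * size y).+1 + ((5 * size y).+1 + t2.+1)) z.
Proof.
move=> H1 H2.
have e1_inj : injective e1 by move=> ? ? [].
have e2_inj : injective e2 by move=> ? ? [].
have [|ts1 [R1 V1 F1]] := @outputs_run I M1 e1 (init (e1 (tm_in M1)) x) x t1 y e1_inj _ H1.
  by move=> j; rewrite ffunE (inj_eq e1_inj).
pose blank2 (ts : tapes I) (w : seq bool) :=
  forall j, teq (ts (e2 j)) (if j == tm_in M2 then input_tape w else Tape [::] None [::]).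
pose P1 s (ts : tapes I) :=
  [/\ bits (ts (e1 (tm_out M1))) = s, catrev s (bits (ts tmp)) = rev y & blank2 ts [::]].
have [| | |ts2 R2 [_ T2 B2]] := @exec_Drain I (e1 (tm_out M1)) (Push tmp) 2 P1 _ _ y ts1.
- by move=> s ts [].
- move=> b s ts [Vs Ps Bs]; eexists; first exact: exec_Push.
  split; first by rewrite upd_other // upd_same (val_tpop Vs).
    by rewrite upd_same val_tpush -Ps /= upd_other.
  by move=> j; rewrite !upd_other.
- split=> //; first by rewrite F1 // ffunE.
  by move=> j; rewrite F1 // ffunE /=; case: ifP.
pose P2 s (ts : tapes I) :=
  bits (ts tmp) = s /\ exists2 w, catrev s w = y & blank2 ts w.
have [| | |ts3 R3 [_ [w Ew B3]]] := @exec_Drain I tmp (Push (e2 (tm_in M2))) 2 P2 _ _ (rev y) ts2.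
- by move=> s ts [].
- move=> b s ts [Vs [w Ew Bs]]; eexists; first exact: exec_Push.
  split; first by rewrite upd_other // upd_same (val_tpop Vs).
  exists (b :: w) => // j; have := Bs j.
  case: (eqVneq j (tm_in M2)) => [->|Hj].
    by rewrite upd_same upd_other // => Hb; apply: teq_input_push.
  by rewrite !upd_other // (inj_eq e2_inj).
- by split; [exact: T2 | exists [::] => //; rewrite -/(rev _) revK].
rewrite /= in Ew; rewrite {w}Ew in B3.
have [ts4 [R4 <- _]] := @outputs_run I M2 e2 ts3 y t2 z e2_inj B3 H2.
apply: flow_TM_outputs; rewrite size_rev in R3.
exact: exec_Seq (exec_Seq R1 R2) (exec_Seq R3 R4).
Qed.

End Comp.

Lemma polytime_comp (f g : seq bool -> seq bool) (M : TM) :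
  polytime f -> computes_on M f g -> polytime g.
Proof.
move=> /polytimeP [M1 [k Hk]] [l Hl]; apply/polytimeP; exists (comp_TM M1 M).
have [m Hm] : PB (fun n => (bnd k n).+1 + (5 * (n + bnd k n + 1)).+1 +
   ((5 * (n + bnd k n + 1)).+1 + (bnd l (n + bnd k n + 1)).+1)).
  have Pk := PB_bnd k; have P1 := PB_const 1; have P5 := PB_const 5.
  have Ps : PB (fun n => n + bnd k n + 1) by exact: PB_add (PB_add PB_id Pk) P1.
  have PS f' : PB f' -> PB (fun n => (f' n).+1).
    by move=> Pf; apply: PB_le (PB_add Pf P1) => n; rewrite addn1.
  have P5s := PS _ (PB_mul P5 Ps).
  exact: PB_add (PB_add (PS _ Pk) P5s) (PB_add P5s (PS _ (PB_comp (PB_bnd l) Ps))).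
exists m => x; have [t1 Ht1 H1] := Hk x; have [t2 Ht2 H2] := Hl x.
eexists; last exact: comp_TM_outputs H1 H2.
apply: leq_trans (Hm _).
have := size_outputs H1 => Hs.
have Hs' : size (f x) <= size x + bnd k (size x) + 1.
  by apply: leq_trans Hs _; rewrite leq_add2r leq_add2l.
have := bnd_mono l Hs'; simpl in *; lia.
Qed.

(** * Returning the input along with the output *)

Section Keep.
Variable M : TM.

Let I := (tm_tape M + 'I_3)%type.
Let e (j : tm_tape M) : I := inl j.
Let src : I := inr (@Ordinal 3 0 isT).
Let t1 : I := inr (@Ordinal 3 1 isT).
Let t2 : I := inr (@Ordinal 3 2 isT).

(** One copy of the input is consumed by [M], hence the second one on [t2]. Both copies are
    reversed: draining [t1] restores the input, and draining [t2] onto the output, last bit first,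
    builds [enc_string x] in front of it, starting from its terminator [false]. *)
Definition keep_TM : TM :=
  @flow_TM I (Seq (Seq (Drain src (fun b => Seq (Push t1 b) (Push t2 b)))
                       (Drain t1 (Push (e (tm_in M)))))
     (Seq (Call e) (Seq (Push (e (tm_out M)) false)
        (Drain t2 (fun b => Seq (Push (e (tm_out M)) b) (Push (e (tm_out M)) true))))))
   src (e (tm_out M)).

Lemma enc_string_cons b s : enc_string (b :: s) = true :: b :: enc_string s.
Proof. by []. Qed.

Lemma keep_TM_outputs x t y : tm_outputs M x t y ->
  tm_outputs keep_TM x ((7 * size x).+1 + (5 * size x).+1 + (t.+1 + (2 + (7 * size x).+1)))
    (enc_string x ++ y).
Proof.
move=> H; have e_inj : injective e by move=> ? ? [].
pose blank (ts : tapes I) (w : seq bool) :=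
  forall j, teq (ts (e j)) (if j == tm_in M then input_tape w else Tape [::] None [::]).
pose P1 s (ts : tapes I) :=
  [/\ bits (ts src) = s, catrev s (bits (ts t1)) = rev x, catrev s (bits (ts t2)) = rev x
    & blank ts [::]].
have [| | |ts1 R1 [_ V1 W1 B1]] := @exec_Drain I src (fun b => Seq (Push t1 b) (Push t2 b)) 4 P1 _ _ x (init src x).
- by move=> s ts [].
- move=> b s ts [Vs Ps Qs Bs].
  eexists; first exact: exec_Seq (exec_Push _ _ _) (exec_Push _ _ _).
  split; first by rewrite !ffunE /= ?eqxx // (val_tpop Vs).
  + by rewrite !ffunE /= ?eqxx.
  + by rewrite !ffunE /= ?eqxx.
  + by move=> j; rewrite !upd_other.
- split; rewrite ?ffunE //=; first by rewrite val_input.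
  by move=> j; rewrite ffunE /=; case: ifP.
rewrite /= in V1 W1.
pose P2 s (ts : tapes I) :=
  [/\ bits (ts t1) = s, bits (ts t2) = rev x & exists2 w, catrev s w = x & blank ts w].
have [| | |ts2 R2 [_ V2 [w Ew B2]]] := @exec_Drain I t1 (Push (e (tm_in M))) 2 P2 _ _ (rev x) ts1.
- by move=> s ts [].
- move=> b s ts [Vs Ps [w Ew Bs]]; eexists; first exact: exec_Push.
  split; rewrite ?ffunE /= ?eqxx ?(val_tpop Vs) //.
  exists (b :: w) => // j; have := Bs j.
  case: (eqVneq j (tm_in M)) => [->|Hj].
    by rewrite upd_same => Hb; apply: teq_input_push.
  by rewrite !upd_other // (inj_eq e_inj).
- by split=> //; exists [::]; rewrite // -/(rev _) revK.
rewrite /= in Ew; rewrite {w}Ew in B2.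
have [ts3 [R3 V3 F3]] := @outputs_run I M e ts2 x t y e_inj B2 H.
pose P4 s (ts : tapes I) :=
  [/\ bits (ts t2) = s & exists2 w, catrev s w = x & bits (ts (e (tm_out M))) = enc_string w ++ y].
have R4 := exec_Push (e (tm_out M)) false ts3; set ts4 := upd _ _ _ in R4.
have [| | |ts5 R5 [_ [w Ew V5]]] := @exec_Drain I t2 (fun b => Seq (Push (e (tm_out M)) b) (Push (e (tm_out M)) true)) 4 P4 _ _ (rev x) ts4.
- by move=> s ts [].
- move=> b s ts [Vs [w Ew Hw]].
  eexists; first exact: exec_Seq (exec_Push _ _ _) (exec_Push _ _ _).
  split; rewrite !ffunE /= ?eqxx // ?(val_tpop Vs) //.
  by exists (b :: w) => //; rewrite !val_tpush Hw.
- split; first by rewrite upd_other // F3.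
  exists [::]; first by rewrite -/(rev _) revK.
  by rewrite upd_same val_tpush V3.
rewrite /= in Ew; rewrite {w}Ew in V5; rewrite -V5.
apply: flow_TM_outputs; rewrite size_rev in R2 R5.
exact: exec_Seq (exec_Seq R1 R2) (exec_Seq R3 (exec_Seq R4 R5)).
Qed.

End Keep.

Lemma polytime_keep f : polytime f -> polytime (fun x => enc_string x ++ f x).
Proof.
move=> /polytimeP [M [k Hk]]; apply/polytimeP; exists (keep_TM M).
have [m Hm] : PB (fun n => 19 * n + bnd k n + 6).
  apply: PB_add (PB_const _); apply: PB_add (PB_bnd k).
  exact: PB_mul (PB_const _) PB_id.
exists m => x; have [t Ht H] := Hk x; eexists; last exact: keep_TM_outputs H.
by apply: leq_trans (Hm _); simpl in *; lia.
Qed.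

(** * Programs on four stacks *)

(** Stack [rA] carries arguments and values, [rB] and [rC] receive trees that are set aside, and
    [rD] holds the counter that finds the end of a tree. *)
Definition reg := (bool * bool)%type.
Notation rA := ((false, false) : reg).
Notation rB := ((false, true) : reg).
Notation rC := ((true, false) : reg).
Notation rD := ((true, true) : reg).

Definition store := (seq bool * seq bool * seq bool * seq bool)%type.

Definition get (s : store) (r : reg) : seq bool :=
  let: (a, b, c, d) := s in
  match r with
  | (false, false) => a | (false, true) => b | (true, false) => c | (true, true) => d
  end.

Definition set (s : store) (r : reg) (x : seq bool) : store :=
  let: (a, b, c, d) := s in
  match r with
  | (false, false) => (x, b, c, d) | (false, true) => (a, x, c, d)
  | (true, false) => (a, b, x, d) | (true, true) => (a, b, c, x)
  end.

Lemma get_set s r x r' : get (set s r x) r' = if r' == r then x else get s r'.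
Proof. by case: s => [[[a b] c] d]; case: r => [[] []]; case: r' => [[] []]. Qed.

Definition holds (ts : tapes reg) (s : store) := forall r, bits (ts r) = get s r.

Variant runs (p : flow reg) (s : store) (n : nat) (s' : store) : Prop :=
  Runs of forall ts, holds ts s -> exists2 ts', exec p ts n ts' & holds ts' s'.

Lemma runs_le p s n m s' : runs p s n s' -> n <= m -> runs p s m s'.
Proof.
move=> [H] le; split=> ts /H [ts' H1 H2]; exists ts' => //; exact: exec_mono H1 le.
Qed.

Lemma runs_Seq p q s n s1 m s2 :
  runs p s n s1 -> runs q s1 m s2 -> runs (Seq p q) s (n + m) s2.
Proof.
move=> [Hp] [Hq]; split=> ts /Hp [ts1 E1 /Hq [ts2 E2 H2]]; exists ts2 => //.
exact: exec_Seq E1 E2.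
Qed.

Lemma runs_Push r b s : runs (Push r b) s 2 (set s r (b :: get s r)).
Proof.
split=> ts H; eexists; first exact: exec_Push.
by move=> r'; rewrite ffunE get_set; case: eqP => // _; rewrite val_tpush H.
Qed.

Lemma runs_Pop r b s x : get s r = b :: x -> runs (Pop r) s 1 (set s r x).
Proof.
move=> Hr; split=> ts H; eexists; first exact: exec_Pop.
move=> r'; rewrite ffunE get_set; case: eqP => // _.
by apply: (@val_tpop _ b); rewrite H.
Qed.

Definition IfT r p q : flow reg := If (pred1 (Some true)) r p q.

Lemma runs_IfT r p q s n s' :
  runs (if ohead (get s r) == Some true then p else q) s n s' -> runs (IfT r p q) s n.+1 s'.
Proof.
move=> [H]; split=> ts Hts; have [ts' E H'] := H ts Hts; exists ts' => //.
by apply: exec_If; rewrite head_val Hts.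
Qed.

Definition WhileT r p : flow reg := While (pred1 (Some true)) r p.

Lemma runs_stop r p s : ohead (get s r) != Some true -> runs (WhileT r p) s 1 s.
Proof.
move=> H; split=> ts Hts; exists ts => //; apply: exec_While_stop.
by rewrite head_val Hts.
Qed.

Lemma runs_step r p s n s1 m s2 : ohead (get s r) = Some true ->
  runs p s n s1 -> runs (WhileT r p) s1 m s2 -> runs (WhileT r p) s (n + m).+1 s2.
Proof.
move=> H [Hp] [Hw]; split=> ts Hts; have [ts1 E1 /Hw [ts2 E2 H2]] := Hp ts Hts; exists ts2 => //.
by apply: exec_While_step E1 E2; rewrite head_val Hts H /=.
Qed.

Definition Skip : flow reg := Do rA None Stay.

Lemma runs_Skip s : runs Skip s 1 s.
Proof.
split=> ts Hts; eexists; first exact: exec_Do.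
move=> r; rewrite ffunE -Hts; case: eqP => [->|//].
by case: (ts rA).
Qed.

Section Registers.
Variables (x : bool) (a b c d : seq bool).

Lemma popA : runs (Pop rA) (x :: a, b, c, d) 1 (a, b, c, d).
Proof. exact: (@runs_Pop rA x (x :: a, b, c, d)). Qed.
Lemma popB : runs (Pop rB) (a, x :: b, c, d) 1 (a, b, c, d).
Proof. exact: (@runs_Pop rB x (a, x :: b, c, d)). Qed.
Lemma popD : runs (Pop rD) (a, b, c, x :: d) 1 (a, b, c, d).
Proof. exact: (@runs_Pop rD x (a, b, c, x :: d)). Qed.
Lemma pushA : runs (Push rA x) (a, b, c, d) 2 (x :: a, b, c, d).
Proof. exact: (runs_Push rA x (a, b, c, d)). Qed.
Lemma pushB : runs (Push rB x) (a, b, c, d) 2 (a, x :: b, c, d).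
Proof. exact: (runs_Push rB x (a, b, c, d)). Qed.
Lemma pushC : runs (Push rC x) (a, b, c, d) 2 (a, b, x :: c, d).
Proof. exact: (runs_Push rC x (a, b, c, d)). Qed.
Lemma pushD : runs (Push rD x) (a, b, c, d) 2 (a, b, c, x :: d).
Proof. exact: (runs_Push rD x (a, b, c, d)). Qed.

End Registers.

(** * Trees and their prefix codes *)

Inductive tree := Leaf | Node of tree & tree.

(** Preorder notation. It is prefix-free, so a tree on top of a stack needs no end marker. *)
Fixpoint code t := if t is Node t1 t2 then true :: code t1 ++ code t2 else [:: false].

Fixpoint tree_size t := if t is Node t1 t2 then (tree_size t1 + tree_size t2).+1 else 1.

Lemma size_code t : size (code t) = tree_size t.
Proof. by elim: t => //= t1 <- t2 <-; rewrite size_cat. Qed.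

Lemma tree_size_gt0 t : 0 < tree_size t.
Proof. by case: t. Qed.

Definition scan_loop (body : bool -> flow reg) : flow reg :=
  WhileT rD (IfT rA (Seq (Pop rA) (Seq (Push rD true) (body true)))
                    (Seq (Pop rA) (Seq (Pop rD) (body false)))).

(** The bit [false] is a floor for the unary counter, as the earlier contents of [rD] may begin with
    [true]. *)
Definition Scan body : flow reg :=
  Seq (Push rD false) (Seq (Push rD true) (Seq (scan_loop body) (Pop rD))).

Section Scan.
Variables (body : bool -> flow reg) (k : nat).
Variable f : seq bool * seq bool -> bool -> seq bool * seq bool.
Hypothesis runs_body : forall x a b c d,
  runs (body x) (a, b, c, d) k (a, (f (b, c) x).1, (f (b, c) x).2, d).

Let ff (bc : seq bool * seq bool) t := foldl f bc (code t).

(* The unary counter on [rD] is the number of subtrees still to be read. *)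
Lemma runs_scan_loop t a b c d m s :
  runs (scan_loop body) (a, (ff (b, c) t).1, (ff (b, c) t).2, d) m s ->
  runs (scan_loop body) (code t ++ a, b, c, true :: d) (m + (k + 5) * tree_size t) s.
Proof.
elim: t a b c d m s => [|t1 IH1 t2 IH2] a b c d m s.
  rewrite /ff /= => H.
  apply: (runs_le (n := ((1 + (1 + k)).+1 + m).+1)); last by lia.
  apply: runs_step H => //; apply: runs_IfT => /=.
  exact: runs_Seq (popA _ _ _ _ _) (runs_Seq (popD _ _ _ _ _) (runs_body _ _ _ _ _)).
move=> H.
apply: (runs_le (n := ((1 + (2 + k)).+1 + (m + (k + 5) * tree_size t2 + (k + 5) * tree_size t1)).+1)); last by rewrite /=; lia.
apply: (@runs_step _ _ _ _ (code t1 ++ (code t2 ++ a), (f (b, c) true).1, (f (b, c) true).2, [:: true, true & d])) => //.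
  apply: runs_IfT => /=; rewrite catA.
  exact: runs_Seq (popA _ _ _ _ _) (runs_Seq (pushD _ _ _ _ _) (runs_body _ _ _ _ _)).
apply: IH1; rewrite -!surjective_pairing.
case E : (ff _ t1) => [b1 c1]; apply: IH2; rewrite -E.
by move: H; rewrite /ff /= foldl_cat.
Qed.

Lemma runs_Scan t a b c d :
  runs (Scan body) (code t ++ a, b, c, d) ((k + 5) * tree_size t + 6)
    (a, (ff (b, c) t).1, (ff (b, c) t).2, d).
Proof.
apply: (runs_le (n := 2 + (2 + ((1 + (k + 5) * tree_size t) + 1)))); last by lia.
apply: runs_Seq (pushD _ _ _ _ _) (runs_Seq (pushD _ _ _ _ _) _).
apply: (@runs_Seq _ _ _ _ (a, (ff (b, c) t).1, (ff (b, c) t).2, false :: d)).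
  by apply: runs_scan_loop; apply: runs_stop.
exact: popD.
Qed.

End Scan.

(* The reversed code of a tree is not prefix-free, so each of its bits is preceded by
   a mark [true] and the last one is followed by [false], as in [enc_string]. *)
Definition PushB b := Seq (Push rB b) (Push rB true).
Definition PushC b := Seq (Push rC b) (Push rC true).
Definition GrabB := Seq (Push rB false) (Scan PushB).
Definition GrabC := Seq (Push rC false) (Scan PushC).
Definition GrabBC :=
  Seq (Push rB false) (Seq (Push rC false) (Scan (fun b => Seq (PushB b) (PushC b)))).
Definition Drop := Scan (fun=> Skip).

Definition pushb (w : seq bool) (s : seq bool) := foldl (fun w b => [:: true, b & w]) w s.

Lemma pushb_enc s w b : pushb (enc_string w ++ b) s = enc_string (catrev s w) ++ b.
Proof. by elim: s w => //= x s IHs w; rewrite -IHs. Qed.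

Lemma runs_GrabB t a b c d :
  runs GrabB (code t ++ a, b, c, d) (9 * tree_size t + 8)
    (a, enc_string (rev (code t)) ++ b, c, d).
Proof.
apply: (runs_le (n := 2 + ((4 + 5) * tree_size t + 6))); last by lia.
apply: runs_Seq (pushB _ _ _ _ _) _.
have := @runs_Scan PushB 4 (fun bc x => ([:: true, x & bc.1], bc.2)) _ t a (false :: b) c d.
have -> : foldl (fun bc x => ([:: true, x & bc.1], bc.2)) (false :: b, c) (code t)
   = (pushb (false :: b) (code t), c).
  by elim: (code t) (false :: b) => //= x s IHs w; rewrite IHs.
rewrite -[false :: b]/(enc_string [::] ++ b) pushb_enc; apply.
by move=> x {}a {}b {}c {}d; apply: runs_Seq (pushB _ _ _ _ _) (pushB _ _ _ _ _).
Qed.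

Lemma runs_GrabC t a b c d :
  runs GrabC (code t ++ a, b, c, d) (9 * tree_size t + 8)
    (a, b, enc_string (rev (code t)) ++ c, d).
Proof.
apply: (runs_le (n := 2 + ((4 + 5) * tree_size t + 6))); last by lia.
apply: runs_Seq (pushC _ _ _ _ _) _.
have := @runs_Scan PushC 4 (fun bc x => (bc.1, [:: true, x & bc.2])) _ t a b (false :: c) d.
have -> : foldl (fun bc x => (bc.1, [:: true, x & bc.2])) (b, false :: c) (code t)
   = (b, pushb (false :: c) (code t)).
  by elim: (code t) (false :: c) => //= x s IHs w; rewrite IHs.
rewrite -[false :: c]/(enc_string [::] ++ c) pushb_enc; apply.
by move=> x {}a {}b {}c {}d; apply: runs_Seq (pushC _ _ _ _ _) (pushC _ _ _ _ _).
Qed.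

Lemma runs_GrabBC t a b c d :
  runs GrabBC (code t ++ a, b, c, d) (13 * tree_size t + 10)
    (a, enc_string (rev (code t)) ++ b, enc_string (rev (code t)) ++ c, d).
Proof.
apply: (runs_le (n := 2 + (2 + ((8 + 5) * tree_size t + 6)))); last by lia.
apply: runs_Seq (pushB _ _ _ _ _) (runs_Seq (pushC _ _ _ _ _) _).
have := @runs_Scan (fun b => Seq (PushB b) (PushC b)) 8
  (fun bc x => ([:: true, x & bc.1], [:: true, x & bc.2])) _ t a (false :: b) (false :: c) d.
have -> : foldl (fun bc x => ([:: true, x & bc.1], [:: true, x & bc.2])) (false :: b, false :: c) (code t)
   = (pushb (false :: b) (code t), pushb (false :: c) (code t)).
  by elim: (code t) (false :: b) (false :: c) => //= x s IHs w w'; rewrite IHs.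
rewrite -[false :: b]/(enc_string [::] ++ b) -[false :: c]/(enc_string [::] ++ c) !pushb_enc; apply.
move=> x {}a {}b {}c {}d.
exact: runs_Seq (runs_Seq (pushB _ _ _ _ _) (pushB _ _ _ _ _)) (runs_Seq (pushC _ _ _ _ _) (pushC _ _ _ _ _)).
Qed.

Lemma runs_Drop t a b c d : runs Drop (code t ++ a, b, c, d) (6 * tree_size t + 6) (a, b, c, d).
Proof.
have := @runs_Scan (fun=> Skip) 1 (fun bc x => bc) _ t a b c d.
have -> : foldl (fun bc (x : bool) => bc) (b, c) (code t) = (b, c) by elim: (code t).
by apply=> *; apply: runs_Skip.
Qed.

(** Moving bits between stacks reverses them, so a code that was set aside in reverse returns to
    [rA] in its original order. *)
Definition Unload r : flow reg :=
  Seq (WhileT r (Seq (Pop r) (IfT r (Seq (Pop r) (Push rA true)) (Seq (Pop r) (Push rA false)))))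
      (Pop r).

Lemma runs_Unload r s w x : r != rA -> get s r = enc_string w ++ x ->
  runs (Unload r) s (6 * size w + 2) (set (set s r x) rA (rev w ++ get s rA)).
Proof.
move=> rA' Hs; apply: (runs_le (n := 6 * size w + 1 + 1)); last by lia.
apply: (@runs_Seq _ _ _ _ (set (set s r (false :: x)) rA (rev w ++ get s rA))); last first.
  have -> : set (set s r x) rA (rev w ++ get s rA) = set (set (set s r (false :: x)) rA (rev w ++ get s rA)) r x.
    by case: s {Hs} => [[[a b] c] d]; move: rA'; case: r => [[] []].
  by apply: (@runs_Pop _ false); rewrite !get_set eqxx (negPf rA').
elim: w s Hs => [|b w IHw] s Hs /=.
  have -> : set (set s r (false :: x)) rA (get s rA) = s.
    by case: s Hs => [[[a b] c] d]; move: rA'; case: r => [[] []] //= _ ->.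
  by apply: runs_stop; rewrite Hs.
apply: (runs_le (n := (1 + (1 + 2).+1 + (6 * size w + 1)).+1)); last by lia.
apply: (@runs_step _ _ _ _ (set (set s r (enc_string w ++ x)) rA (b :: get s rA))); first by rewrite Hs.
  apply: runs_Seq; first by apply: (@runs_Pop _ true); rewrite Hs enc_string_cons.
  apply: runs_IfT; rewrite get_set eqxx /=.
  have HP : runs (Pop r) (set s r (b :: enc_string w ++ x)) 1 (set s r (enc_string w ++ x)).
    have -> : set s r (enc_string w ++ x) = set (set s r (b :: enc_string w ++ x)) r (enc_string w ++ x).
      by case: s {Hs IHw} => [[[? ?] ?] ?]; case: r rA' => [[] []].
    by apply: (@runs_Pop _ b); rewrite get_set eqxx.
  have HA : get (set s r (enc_string w ++ x)) rA = get s rA.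
    by rewrite get_set eq_sym (negPf rA').
  by case: b {Hs} HP => HP /=; rewrite -HA; apply: runs_Seq HP (runs_Push _ _ _).
have := IHw (set (set s r (enc_string w ++ x)) rA (b :: get s rA)).
rewrite !get_set eqxx (negPf rA') => /(_ (erefl _)).
congr runs; rewrite rev_cons cat_rcons.
by case: s {Hs IHw} => [[[? ?] ?] ?]; case: r rA' => [[] []].
Qed.

Definition Dup := Seq GrabBC (Seq (Unload rB) (Unload rC)).

Lemma runs_Dup t a b c d :
  runs Dup (code t ++ a, b, c, d) (25 * tree_size t + 14) (code t ++ code t ++ a, b, c, d).
Proof.
apply: (runs_le (n := 13 * tree_size t + 10 + ((6 * tree_size t + 2) + (6 * tree_size t + 2)))); last by lia.
apply: runs_Seq (runs_GrabBC _ _ _ _ _) _; rewrite -!size_code -!(size_rev (code t)).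
apply: runs_Seq; first exact: runs_Unload.
by have := @runs_Unload rC (rev (rev (code t)) ++ a, b, enc_string (rev (code t)) ++ c, d) _ c isT (erefl _); rewrite /= revK.
Qed.

Definition Swap := Seq (Seq GrabB GrabC) (Seq (Unload rB) (Unload rC)).

Lemma runs_Swap t u a b c d :
  runs Swap (code t ++ code u ++ a, b, c, d) (15 * (tree_size t + tree_size u) + 20)
    (code u ++ code t ++ a, b, c, d).
Proof.
apply: (runs_le (n := (9 * tree_size t + 8 + (9 * tree_size u + 8)) + ((6 * tree_size t + 2) + (6 * tree_size u + 2)))); last by lia.
apply: runs_Seq (runs_Seq (runs_GrabB _ _ _ _ _) (runs_GrabC _ _ _ _ _)) _.
rewrite -!size_code -!(size_rev (code _)).
apply: runs_Seq; first exact: runs_Unload.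
by have := @runs_Unload rC (rev (rev (code t)) ++ a, b, enc_string (rev (code u)) ++ c, d) _ c isT (erefl _); rewrite /= !revK.
Qed.

(** * Polynomial time functions between coded types *)

Lemma PB_succ f : PB f -> PB (fun n => (f n).+1).
Proof. by move=> Pf; apply: PB_le (PB_add Pf (PB_const 1)) => n; rewrite addn1. Qed.

Ltac pb := lazymatch goal with
  | |- PB (fun _ => ?c) => exact: (PB_const c)
  | |- PB (fun n => n) => exact: PB_id
  | |- PB (fun n => bnd ?k n) => exact: (PB_bnd k)
  | |- PB (fun n => bnd ?k (@?g n)) => apply: (@PB_comp (bnd k) g); [exact: PB_bnd | pb]
  | |- PB (fun n => @?f n + @?g n) => apply: (@PB_add f g); pb
  | |- PB (fun n => @?f n * @?g n) => apply: (@PB_mul f g); pb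
  | |- PB (fun n => (@?f n).+1) => apply: (@PB_succ f); pb
  | _ => idtac
  end.

(** Values of different types may share a tree, as a nonempty list and the pair of its head and tail
    do; passing from one to the other then takes no computation on the stack. *)
Class coded (A : Type) := tc : A -> tree.

Instance coded_tree : coded tree := id.
Instance coded_bool : coded bool := fun b => if b then Node Leaf Leaf else Leaf.
Instance coded_prod (A B : Type) `{coded A} `{coded B} : coded (A * B) :=
  fun p => Node (tc p.1) (tc p.2).
Instance coded_seq (A : Type) `{coded A} : coded (seq A) :=
  foldr (fun x t => Node (tc x) t) Leaf.
(** Binary digits keep the tree of a number proportional to its numeral, as running times are
    measured against binary encodings. *)
Instance coded_nat : coded nat := fun n => tc (nat_bits n).

Definition sz {A : Type} `{coded A} (a : A) := tree_size (tc a).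

Lemma sz_pair {A B : Type} `{coded A} `{coded B} (a : A) (b : B) :
  sz (a, b) = (sz a + sz b).+1.
Proof. by []. Qed.

Lemma sz_cons {A : Type} `{coded A} (x : A) s : sz (x :: s) = (sz x + sz s).+1.
Proof. by []. Qed.

Lemma sz_nil {A : Type} `{coded A} : sz ([::] : seq A) = 1.
Proof. by []. Qed.

Lemma sz_gt0 {A : Type} `{coded A} (a : A) : 0 < sz a.
Proof. exact: tree_size_gt0. Qed.

Lemma sz_bool (b : bool) : sz b <= 3.
Proof. by case: b. Qed.

(** The size of [f a] is bounded along with the time because the next program in a composition is
    timed by it. *)
Definition tpt {A B : Type} `{coded A} `{coded B} (f : A -> B) : Prop :=
  exists P k, forall a, sz (f a) <= bnd k (sz a) /\
    forall r b c d, runs P (code (tc a) ++ r, b, c, d) (bnd k (sz a))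
                           (code (tc (f a)) ++ r, b, c, d).

Lemma tptI {A B : Type} `{coded A} `{coded B} (f : A -> B) P S T :
  PB S -> PB T ->
  (forall a, sz (f a) <= S (sz a)) ->
  (forall a r b c d, runs P (code (tc a) ++ r, b, c, d) (T (sz a))
                           (code (tc (f a)) ++ r, b, c, d)) -> tpt f.
Proof.
move=> [k Hk] [l Hl] Hs Hr; exists P, (k + l) => a; split.
  apply: leq_trans (Hs a) _; apply: leq_trans (Hk _) _.
  exact: bnd_le (leq_addr _ _).
move=> r b c d; apply: runs_le (Hr _ _ _ _ _) _.
by apply: leq_trans (Hl _) _; apply: bnd_le; apply: leq_addl.
Qed.

Lemma tpt_cast {A B : Type} {cA : coded A} {cB : coded B}
    (f : A -> B) : (forall a, tc (f a) = tc a) -> tpt f.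
Proof.
move=> Hf; apply: (@tptI _ _ _ _ f Skip (fun n => n) (fun n => 1)); [pb|pb| |].
  by move=> a; rewrite /sz Hf.
by move=> a r b c d; rewrite Hf; apply: runs_Skip.
Qed.

Lemma tpt_id {A : Type} {cA : coded A} : tpt (fun a : A => a).
Proof. exact: tpt_cast. Qed.

Lemma tpt_retype {A B C : Type} {cA : coded A} {cB : coded B} {cC : coded C}
    (f : A -> B) (g : A -> C) :
  (forall a, tc (g a) = tc (f a)) -> tpt f -> tpt g.
Proof.
move=> E [P [k Hk]]; exists P, k => a; have [H1 H2] := Hk a.
by rewrite /sz E; split=> // *; rewrite E; apply: H2.
Qed.

Lemma tpt_ext {A B : Type} {cA : coded A} {cB : coded B}
    (f g : A -> B) : f =1 g -> tpt f -> tpt g.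
Proof. by move=> E; apply: tpt_retype => a; rewrite E. Qed.

Lemma tpt_comp {A B C : Type} {cA : coded A} {cB : coded B} {cC : coded C}
    (f : A -> B) (g : B -> C) : tpt f -> tpt g -> tpt (fun a => g (f a)).
Proof.
move=> [P [k Hk]] [Q [l Hl]].
apply: (@tptI _ _ _ _ _ (Seq P Q) (fun n => bnd l (bnd k n)) (fun n => bnd k n + bnd l (bnd k n)));
  [pb|pb| |] => a; have [H1 H2] := Hk a; have [H3 H4] := Hl (f a);
  have H5 := bnd_mono l H1.
  exact: leq_trans H3 H5.
move=> r b c d; apply: runs_le (runs_Seq (H2 _ _ _ _) (H4 _ _ _ _)) _.
by rewrite leq_add2l.
Qed.

Lemma tpt_pair {A B C : Type} {cA : coded A} {cB : coded B} {cC : coded C}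
    (f : A -> B) (g : A -> C) : tpt f -> tpt g -> tpt (fun a => (f a, g a)).
Proof.
move=> [P [k Hk]] [Q [l Hl]].
apply: (@tptI _ _ _ _ _ (Seq Dup (Seq P (Seq Swap (Seq Q (Seq Swap (Push rA true))))))
  (fun n => (bnd k n + bnd l n).+1)
  (fun n => 40 * n + 40 * bnd k n + 40 * bnd l n + 100)); [pb|pb| |] => a;
  have [H1 H2] := Hk a; have [H3 H4] := Hl a.
  by rewrite sz_pair; lia.
move=> r b c d.
have -> : code (tc (f a, g a)) ++ r = true :: code (tc (f a)) ++ code (tc (g a)) ++ r.
  by rewrite /= -catA.
apply: runs_le; first apply: runs_Seq (runs_Dup _ _ _ _ _) (runs_Seq (H2 _ _ _ _)
  (runs_Seq (runs_Swap _ _ _ _ _ _) (runs_Seq (H4 _ _ _ _)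
    (runs_Seq (runs_Swap _ _ _ _ _ _) (pushA _ _ _ _ _))))).
by move: H1 H3; rewrite /sz; lia.
Qed.

Lemma tpt_fst {A B : Type} {cA : coded A} {cB : coded B} : tpt (fun p : A * B => p.1).
Proof.
apply: (@tptI _ _ _ _ _ (Seq (Pop rA) (Seq Swap Drop)) (fun n => n)
  (fun n => 40 * n + 40)); [pb|pb| |] => -[a b]; rewrite sz_pair /=; first by lia.
move=> r b' c d; rewrite /= -catA.
apply: runs_le; first apply: runs_Seq (popA _ _ _ _ _) (runs_Seq (runs_Swap _ _ _ _ _ _) (runs_Drop _ _ _ _ _)).
by rewrite /sz; lia.
Qed.

Lemma tpt_snd {A B : Type} {cA : coded A} {cB : coded B} : tpt (fun p : A * B => p.2).
Proof.
apply: (@tptI _ _ _ _ _ (Seq (Pop rA) Drop) (fun n => n)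
  (fun n => 40 * n + 40)); [pb|pb| |] => -[a b]; rewrite sz_pair /=; first by lia.
move=> r b' c d; rewrite /= -catA.
apply: runs_le; first apply: runs_Seq (popA _ _ _ _ _) (runs_Drop _ _ _ _ _).
by rewrite /sz; lia.
Qed.

Lemma tpt_const {A B : Type} {cA : coded A} {cB : coded B} (y : B) : tpt (fun _ : A => y).
Proof.
have H (t : tree) : tpt (fun _ : A => t); last first.
  exact: (tpt_retype (g := fun=> y) (fun=> erefl) (H (tc y))).
elim: t => [|t1 H1 t2 H2]; last first.
  exact: (tpt_retype (g := fun=> Node t1 t2) (fun=> erefl) (tpt_pair H1 H2)).
apply: (@tptI _ _ _ _ _ (Seq Drop (Push rA false)) (fun=> 1) (fun n => 10 * n + 10)); [pb|pb| |] => a //.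
move=> r b c d.
apply: runs_le; first apply: runs_Seq (runs_Drop _ _ _ _ _) (pushA _ _ _ _ _).
by rewrite /sz; lia.
Qed.

Lemma tpt_if {A B : Type} {cA : coded A} {cB : coded B} (t : A -> bool) (f g : A -> B) :
  tpt t -> tpt f -> tpt g -> tpt (fun a => if t a then f a else g a).
Proof.
move=> [P [k Hk]] [Q [l Hl]] [R [m Hm]].
apply: (@tptI _ _ _ _ _ (Seq Dup (Seq P (IfT rA (Seq Drop Q) (Seq (Pop rA) R))))
  (fun n => bnd l n + bnd m n)
  (fun n => 40 * n + bnd k n + bnd l n + bnd m n + 100)); [pb|pb| |] => a;
  have [H1 H2] := Hk a; have [H3 H4] := Hl a; have [H5 H6] := Hm a.
  by case: (t a); lia.
move=> r b c d.
apply: (runs_le (n := 25 * sz a + 14 + (bnd k (sz a) + (24 + bnd l (sz a) + bnd m (sz a)).+1))); last lia.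
apply: runs_Seq (runs_Dup _ _ _ _ _) (runs_Seq (H2 _ _ _ _) (runs_IfT _)).
case: (t a) => /=.
  apply: runs_le; first apply: runs_Seq (runs_Drop (Node Leaf Leaf) _ _ _ _) (H4 _ _ _ _).
  by rewrite /=; lia.
apply: runs_le; first apply: runs_Seq (popA _ _ _ _ _) (H6 _ _ _ _).
by rewrite /=; lia.
Qed.

(** The code of [x :: s] is that of the pair [(x, s)], so after the test of its first bit it only
    remains to pair it with [a]: a swap and one more node. *)
Lemma tpt_caseseq {A B C : Type} {cA : coded A} {cB : coded B} {cC : coded C}
    (l : A -> seq C) (f : A -> B) (g : A -> C -> seq C -> B) :
  tpt l -> tpt f -> tpt (fun p : A * (C * seq C) => g p.1 p.2.1 p.2.2) ->
  tpt (fun a => if l a is x :: s then g a x s else f a).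
Proof.
move=> [P [k Hk]] [Q [m Hm]] [R [n Hn]].
apply: (@tptI _ _ _ _ _ (Seq Dup (Seq P (IfT rA (Seq Swap (Seq (Push rA true) R)) (Seq (Pop rA) Q))))
  (fun x => bnd m x + bnd n (x + bnd k x).+1)
  (fun x => 40 * x + 40 * bnd k x + bnd m x + bnd n (x + bnd k x).+1 + 100)); [pb|pb| |] => a;
  have [H1 H2] := Hk a; have [H3 H4] := Hm a.
  case E: (l a) => [|x s]; first by lia.
  have [/= H5 _] := Hn (a, (x, s)); apply: leq_trans H5 _; apply: leq_trans _ (leq_addl _ _).
  by apply: bnd_mono; move: H1; rewrite E sz_cons !sz_pair; lia.
move=> r b c d.
apply: (runs_le (n := 25 * sz a + 14 + (bnd k (sz a) +
  (24 + bnd m (sz a) + 15 * sz a + 15 * bnd k (sz a) + bnd n (sz a + bnd k (sz a)).+1).+1))); last lia.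
apply: runs_Seq (runs_Dup _ _ _ _ _) (runs_Seq (H2 _ _ _ _) (runs_IfT _)).
move: H1; case: (l a) => [|x s] H1.
  apply: runs_le; first apply: runs_Seq (popA _ _ _ _ _) (H4 _ _ _ _).
  by rewrite /=; lia.
have [/= _ H6] := Hn (a, (x, s)).
have HR : runs (Seq Swap (Seq (Push rA true) R)) (code (tc (x :: s)) ++ code (tc a) ++ r, b, c, d)
    (15 * (sz (x :: s) + sz a) + 20 + (2 + bnd n (sz (a, (x, s))))) (code (tc (g a x s)) ++ r, b, c, d).
  apply: runs_Seq (runs_Swap _ _ _ _ _ _) (runs_Seq (pushA _ _ _ _ _) _).
  by have := H6 r b c d; rewrite [in X in X -> _]/= -catA; apply.
apply: runs_le; first exact: HR.
have Hb : bnd n (sz (a, (x, s))) <= bnd n (sz a + bnd k (sz a)).+1.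
  by apply: bnd_mono; move: H1; rewrite !sz_pair sz_cons; lia.
by move: H1 Hb; lia.
Qed.

(* [seq C] is the loop counter: the loop stops when it is empty. *)
Lemma runs_iter {C D : Type} {cC : coded C} {cD : coded D}
    (f : seq C * D -> seq C * D) P k :
  (forall a, forall r b c d, runs P (code (tc a) ++ r, b, c, d) (bnd k (sz a))
                           (code (tc (f a)) ++ r, b, c, d)) ->
  forall s m z, (forall j, j < m -> (iter j f z).1 <> [::]) -> (iter m f z).1 = [::] ->
  (forall j, j <= m -> sz (iter j f z) <= s) -> forall r b c d,
  runs (WhileT rA (Seq (Push rA true) (Seq P (Pop rA))))
    (code (tc z.1) ++ code (tc z.2) ++ r, b, c, d)
    ((bnd k s + 4) * m + 1)
    (code (tc (iter m f z).1) ++ code (tc (iter m f z).2) ++ r, b, c, d).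
Proof.
move=> HP s; elim=> [|m IHm] z H1 H2 H3 r b c d.
  apply: (runs_le (n := 1)); last by lia.
  by apply: runs_stop; move: H2 => /= ->.
apply: (runs_le (n := ((2 + (bnd k s + 1)) + ((bnd k s + 4) * m + 1)).+1)); last by lia.
have Hz := H1 0 isT; have Hsz := H3 0 isT; rewrite /= in Hz Hsz.
apply: (@runs_step _ _ _ _ (code (tc (f z).1) ++ code (tc (f z).2) ++ r, b, c, d)).
- by case: z Hz {H1 H2 H3 Hsz} => -[|x l].
- apply: runs_Seq (pushA _ _ _ _ _) _.
  apply: (runs_Seq (s1 := (true :: code (tc (f z).1) ++ code (tc (f z).2) ++ r, b, c, d))); last exact: popA.
  have := HP z r b c d; rewrite /= -!catA => H.
  by apply: runs_le H _; apply: bnd_mono.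
rewrite iterSr; apply: IHm; rewrite -?iterSr //.
- by move=> j Hj; rewrite -iterSr; apply: H1.
- by move=> j Hj; rewrite -iterSr; apply: H3.
Qed.

(** Popping the node of the pair exposes the counter list, whose first bit is the loop test; pushing
    the node back restores an argument for [f]. Every iterate must have bounded size, since the
    bound on a single round says nothing about repeated growth. *)
Lemma tpt_while {C D : Type} {cC : coded C} {cD : coded D}
    (f : seq C * D -> seq C * D) (K : seq C * D -> nat) q :
  tpt f ->
  (forall z j, j < K z -> (iter j f z).1 <> [::]) ->
  (forall z, (iter (K z) f z).1 = [::]) ->
  (forall z, K z <= bnd q (sz z)) ->
  (forall z j, j <= K z -> sz (iter j f z) <= bnd q (sz z)) ->
  tpt (fun z => iter (K z) f z).
Proof.
move=> [P [k Hk]] H1 H2 H3 H4.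
apply: (@tptI _ _ _ _ _ (Seq (Pop rA) (Seq (WhileT rA (Seq (Push rA true) (Seq P (Pop rA)))) (Push rA true)))
  (bnd q) (fun n => (bnd k (bnd q n) + 4) * bnd q n + 4)); [exact: PB_bnd|pb| |] => z; first exact: H4.
move=> r b c d.
apply: (runs_le (n := 1 + (((bnd k (bnd q (sz z)) + 4) * K z + 1) + 2))); last first.
  have : (bnd k (bnd q (sz z)) + 4) * K z <= (bnd k (bnd q (sz z)) + 4) * bnd q (sz z).
    by rewrite leq_mul2l H3 orbT.
  by lia.
have E (y : seq C * D) : code (tc y) ++ r = true :: code (tc y.1) ++ code (tc y.2) ++ r.
  by rewrite /= -catA.
rewrite !E; apply: runs_Seq (popA _ _ _ _ _) (runs_Seq _ (pushA _ _ _ _ _)).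
apply: runs_iter => //; [by move=> a; case: (Hk a) | exact: H1 | exact: H4].
Qed.

(* The accumulator may only grow by an amount that does not depend on it: otherwise
   iterating could make it exponentially large. *)
Lemma tpt_foldl {Z A X : Type} {cZ : coded Z} {cA : coded A} {cX : coded X}
    (g : Z -> A -> X -> A) (l : Z -> seq X) (a0 : Z -> A) k :
  tpt (fun p : Z * (A * X) => g p.1 p.2.1 p.2.2) -> tpt l -> tpt a0 ->
  (forall z a x, sz (g z a x) <= sz a + bnd k (sz z + sz x)) ->
  tpt (fun z => foldl (g z) (a0 z) (l z)).
Proof.
move=> Hg Hl Ha Hs.
pose F (y : seq X * (Z * A)) : seq X * (Z * A) :=
  if y.1 is x :: s then (s, (y.2.1, g y.2.1 y.2.2 x)) else y.
have HF : tpt F.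
  apply: (@tpt_caseseq _ _ _ _ _ _ (fun y => y.1) (fun y => y)
    (fun y x s => (s, (y.2.1, g y.2.1 y.2.2 x)))); [exact: tpt_fst | exact: tpt_id |].
  have P1 : tpt (fun p : seq X * (Z * A) * (X * seq X) => p.1.2) by exact: (tpt_comp tpt_fst tpt_snd).
  have P2 := tpt_comp P1 tpt_fst. have P3 := tpt_comp P1 tpt_snd.
  have P4 : tpt (fun p : seq X * (Z * A) * (X * seq X) => p.2.1) by exact: (tpt_comp tpt_snd tpt_fst).
  have P5 : tpt (fun p : seq X * (Z * A) * (X * seq X) => p.2.2) by exact: (tpt_comp tpt_snd tpt_snd).
  have := tpt_comp (tpt_pair P2 (tpt_pair P3 P4)) Hg => P6.
  exact: tpt_pair P5 (tpt_pair P2 P6).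
have Fsz2 y j : sz (iter j F y) <= sz y + j * bnd k (sz y) /\
      sz (iter j F y).1 <= sz y.1 /\ (iter j F y).2.1 = y.2.1.
  elim: j => [|j]; first by rewrite /= mul0n addn0.
  rewrite iterS; case: (iter j F y) => -[|x s] [z a]; rewrite /F /= => -[H1 [H2 H3]].
    by split=> //; rewrite mulSn; lia.
  move: H1 H2; rewrite !sz_pair !sz_cons mulSn => H1 H2.
  split; last by split=> //; lia.
  have := Hs z a x; have : bnd k (sz z + sz x) <= bnd k (sz y).
    apply: bnd_mono; rewrite H3; case: {H1 H3} y H2 => [l' [z' a']] /=.
    by rewrite !sz_pair; lia.
  by lia.
have Fsz y j : sz (iter j F y) <= sz y + j * bnd k (sz y) by case: (Fsz2 y j).
have size_sz (s : seq X) : size s <= sz s by elim: s => // x s IH; rewrite sz_cons /=; lia.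
have Fit y j : j <= size y.1 ->
    iter j F y = (drop j y.1, (y.2.1, foldl (g y.2.1) y.2.2 (take j y.1))).
  case: y => s [z a] /=; elim: j => [|j IHj] Hj; first by rewrite take0 drop0.
  rewrite iterS IHj 1?ltnW // /F /=; case: (ltnP j (size s)) Hj => // Hj _.
  have [x _] : exists x : X, True by case: (s) Hj => // x; exists x.
  rewrite (drop_nth x Hj) (take_nth x Hj).
  by rewrite foldl_rcons.
have [q Hq] : PB (fun n => n + n * bnd k n) by pb.
have HW := @tpt_while _ _ _ _ F (fun y => size y.1) q HF.
have {HW} HW : tpt (fun z => iter (size z.1) F z).
  apply: HW.
  - move=> y j Hj; rewrite Fit 1?ltnW //=.
    by case: (y.1) Hj => // x s Hj; rewrite (drop_nth x Hj).
  - by move=> y; rewrite Fit //= drop_size.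
  - move=> [s y]; apply: leq_trans (Hq _); rewrite sz_pair /=; have := size_sz s; lia.
  - move=> y j Hj; apply: leq_trans (Fsz _ _) _; apply: leq_trans (Hq _).
    rewrite leq_add2l leq_mul2r; apply/orP; right; apply: leq_trans Hj _.
    by case: y => s y; rewrite sz_pair /=; have := size_sz s; lia.
have H0 : tpt (fun z => (l z, (z, a0 z))) by apply: tpt_pair => //; apply: tpt_pair => //; apply: tpt_id.
have := tpt_comp (tpt_comp (tpt_comp H0 HW) tpt_snd) tpt_snd.
by apply: tpt_ext => z; rewrite Fit //= take_size.
Qed.

(* Unlike [have := t], this resolves the type class instances in [t]. *)
Ltac use t := let H := fresh in pose proof t as H; move: H.

(** * List and Boolean operations in polynomial time *)

Lemma sz_cat {X : Type} {cX : coded X} (s t : seq X) : (sz (s ++ t)).+1 = sz s + sz t.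
Proof. by elim: s => [|x s IH] //=; rewrite !sz_cons; lia. Qed.

Lemma sz_rev {X : Type} {cX : coded X} (s : seq X) : sz (rev s) = sz s.
Proof.
by elim: s => // x s IH; rewrite rev_cons -cats1; use (sz_cat (rev s) [:: x]); rewrite !sz_cons sz_nil; lia.
Qed.

Lemma bnd1 n : bnd 1 n = n.+2.
Proof. by rewrite /bnd expn1. Qed.

Lemma tpt_fst_of {Z X Y : Type} {cZ : coded Z} {cX : coded X} {cY : coded Y}
    (f : Z -> X * Y) : tpt f -> tpt (fun z => (f z).1).
Proof. by move=> H; apply: tpt_comp H tpt_fst. Qed.

Lemma tpt_snd_of {Z X Y : Type} {cZ : coded Z} {cX : coded X} {cY : coded Y}
    (f : Z -> X * Y) : tpt f -> tpt (fun z => (f z).2).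
Proof. by move=> H; apply: tpt_comp H tpt_snd. Qed.

Lemma tpt_cons {Z X : Type} {cZ : coded Z} {cX : coded X}
    (f : Z -> X) (g : Z -> seq X) : tpt f -> tpt g -> tpt (fun z => f z :: g z).
Proof. by move=> Hf Hg; apply: tpt_retype (tpt_pair Hf Hg). Qed.

Lemma tpt_nonempty {Z X : Type} {cZ : coded Z} {cX : coded X}
    (l : Z -> seq X) : tpt l -> tpt (fun z => if l z is x :: s then true else false).
Proof.
move=> Hl; apply: (@tpt_caseseq _ _ _ _ _ _ _ (fun=> false) (fun _ _ _ => true)) Hl _ _; exact: tpt_const.
Qed.

Lemma tpt_behead {Z X : Type} {cZ : coded Z} {cX : coded X}
    (l : Z -> seq X) : tpt l -> tpt (fun z => behead (l z)).
Proof.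
move=> Hl; use (@tpt_caseseq Z (seq X) X _ _ _ l (fun=> [::]) (fun _ _ s => s) Hl (tpt_const _)).
move=> /(_ (tpt_comp tpt_snd tpt_snd)); apply: tpt_ext => z; by case: (l z).
Qed.

Lemma tpt_and {Z : Type} {cZ : coded Z}
    (f g : Z -> bool) : tpt f -> tpt g -> tpt (fun z => f z && g z).
Proof. by move=> Hf Hg; apply: tpt_if Hf Hg (tpt_const false). Qed.

Lemma tpt_or {Z : Type} {cZ : coded Z}
    (f g : Z -> bool) : tpt f -> tpt g -> tpt (fun z => f z || g z).
Proof. by move=> Hf Hg; apply: tpt_if Hf (tpt_const true) Hg. Qed.

Lemma tpt_neg {Z : Type} {cZ : coded Z} (f : Z -> bool) : tpt f -> tpt (fun z => ~~ f z).
Proof. by move=> Hf; apply: tpt_if Hf (tpt_const false) (tpt_const true). Qed.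

Lemma tpt_eqb {Z : Type} {cZ : coded Z}
    (f g : Z -> bool) : tpt f -> tpt g -> tpt (fun z => f z == g z).
Proof.
move=> Hf Hg; apply: (tpt_ext _ (tpt_if Hf Hg (tpt_neg Hg))) => z.
by case: (f z); case: (g z).
Qed.

(** Descends along the syntax of a function and leaves open what it does not recognise. It is
    extended later, once more operations are covered. *)
Ltac tp := cbv beta; first [ eassumption | lazymatch goal with
  | |- tpt (fun _ => ?c) => exact (tpt_const c)
  | |- tpt (fun z => z) => exact tpt_id
  | |- tpt fst => exact tpt_fst
  | |- tpt snd => exact tpt_snd
  | |- tpt (fun z => fst (@?f z)) => apply (tpt_fst_of (f := f)); tp
  | |- tpt (fun z => snd (@?f z)) => apply (tpt_snd_of (f := f)); tp
  | |- tpt (fun z => pair (@?f z) (@?g z)) => apply (tpt_pair (f := f) (g := g)); tp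
  | |- tpt (fun z => cons (@?f z) (@?g z)) => apply (tpt_cons (f := f) (g := g)); tp
  | |- tpt (fun z => match _ with _ => _ end) => apply tpt_if; tp
  | |- tpt (fun z => andb (@?f z) (@?g z)) => apply (tpt_and (f := f) (g := g)); tp
  | |- tpt (fun z => orb (@?f z) (@?g z)) => apply (tpt_or (f := f) (g := g)); tp
  | |- tpt (fun z => negb (@?f z)) => apply (tpt_neg (f := f)); tp
  | |- tpt (fun z => behead (@?f z)) => apply (tpt_behead (l := f)); tp
  | _ => idtac end ].

Lemma tpt_catrev {Z X : Type} {cZ : coded Z} {cX : coded X}
    (f g : Z -> seq X) : tpt f -> tpt g -> tpt (fun z => catrev (f z) (g z)).
Proof.
move=> Hf Hg.
use (@tpt_foldl Z (seq X) X _ _ _ (fun _ a x => x :: a) f g 1).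
move=> /(_ ltac:(tp) Hf Hg) H; apply: (tpt_ext _ (H _)) => [z|z a x].
  by elim: (f z) (g z) => //= x s IH t; rewrite IH.
by rewrite sz_cons bnd1; lia.
Qed.

Lemma tpt_rev {Z X : Type} {cZ : coded Z} {cX : coded X}
    (f : Z -> seq X) : tpt f -> tpt (fun z => rev (f z)).
Proof. by move=> Hf; apply: tpt_catrev => //; apply: tpt_const. Qed.

Lemma tpt_cat {Z X : Type} {cZ : coded Z} {cX : coded X}
    (f g : Z -> seq X) : tpt f -> tpt g -> tpt (fun z => f z ++ g z).
Proof.
move=> Hf Hg; apply: (tpt_ext _ (tpt_catrev (tpt_rev Hf) Hg)) => z.
by rewrite catrevE revK.
Qed.

Lemma tpt_sz {Z X : Type} {cZ : coded Z} {cX : coded X}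
    (f : Z -> X) : tpt f -> exists k, forall z, sz (f z) <= bnd k (sz z).
Proof. by move=> [P [k Hk]]; exists k => z; case: (Hk z). Qed.

(** The fold collects the result in reverse, adding to the accumulator an amount that depends on the
    current item only; one final reversal restores the order. Mapping and filtering are
    instances. *)
Lemma tpt_flatmap {Z X Y : Type} {cZ : coded Z} {cX : coded X} {cY : coded Y}
    (g : Z -> X -> seq Y) (l : Z -> seq X) :
  tpt (fun p : Z * X => g p.1 p.2) -> tpt l -> tpt (fun z => flatten (map (g z) (l z))).
Proof.
move=> Hg Hl; have [k Hk] := tpt_sz Hg.
have [m Hm] : PB (fun n => bnd k n.+1) by pb.
use (@tpt_foldl Z (seq Y) X _ _ _ (fun z a x => catrev (g z x) a) l (fun=> [::]) m).
move=> /(_ _ Hl (tpt_const _) _) H.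
have {H} H : tpt (fun z => foldl (fun a x => catrev (g z x) a) [::] (l z)).
  apply: H => [|z a x].
    apply: tpt_catrev; last by tp.
    have Hp : tpt (fun p : Z * (seq Y * X) => (p.1, p.2.2)) by tp.
    exact: (tpt_comp Hp Hg).
  use (Hk (z, x)); rewrite sz_pair /= => H1; use (Hm (sz z + sz x)).
  rewrite catrevE; use (sz_cat (rev (g z x)) a); rewrite sz_rev; lia.
apply: (tpt_ext _ (tpt_rev H)) => z.
rewrite -[flatten _]cat0s -{2}[[::]]/(rev [::]); elim: (l z) ([::]) => [|x s IH] a /=.
  by rewrite cats0.
by rewrite IH catrevE rev_cat revK catA.
Qed.

Lemma tpt_flatten {Z X : Type} {cZ : coded Z} {cX : coded X}
    (l : Z -> seq (seq X)) : tpt l -> tpt (fun z => flatten (l z)).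
Proof.
move=> Hl; use (@tpt_flatmap Z (seq X) X _ _ _ (fun _ s => s) l tpt_snd Hl).
by apply: tpt_ext => z; rewrite map_id.
Qed.

Lemma tpt_map {Z X Y : Type} {cZ : coded Z} {cX : coded X} {cY : coded Y}
    (g : Z -> X -> Y) (l : Z -> seq X) :
  tpt (fun p : Z * X => g p.1 p.2) -> tpt l -> tpt (fun z => map (g z) (l z)).
Proof.
move=> Hg Hl.
have H : tpt (fun z => flatten (map (fun x => [:: g z x]) (l z))).
  by apply: tpt_flatmap => //; tp.
by apply: tpt_ext H => z; elim: (l z) => //= x s ->.
Qed.

Lemma tpt_filter {Z X : Type} {cZ : coded Z} {cX : coded X}
    (t : Z -> X -> bool) (l : Z -> seq X) :
  tpt (fun p : Z * X => t p.1 p.2) -> tpt l -> tpt (fun z => filter (t z) (l z)).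
Proof.
move=> Ht Hl.
have H : tpt (fun z => flatten (map (fun x => if t z x then [:: x] else [::]) (l z))).
  by apply: tpt_flatmap => //; tp.
by apply: tpt_ext H => z; elim: (l z) => //= x s ->; case: (t z x).
Qed.

Lemma tpt_all {Z X : Type} {cZ : coded Z} {cX : coded X} (t : Z -> X -> bool) (l : Z -> seq X) :
  tpt (fun p : Z * X => t p.1 p.2) -> tpt l -> tpt (fun z => all (t z) (l z)).
Proof.
move=> Ht Hl.
have H : tpt (fun z => filter (fun x => ~~ t z x) (l z)) by apply: tpt_filter => //; tp.
use (tpt_neg (tpt_nonempty H)); apply: tpt_ext => z.
by elim: (l z) => //= x s IH; case: (t z x).
Qed.

Lemma tpt_has {Z X : Type} {cZ : coded Z} {cX : coded X} (t : Z -> X -> bool) (l : Z -> seq X) :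
  tpt (fun p : Z * X => t p.1 p.2) -> tpt l -> tpt (fun z => has (t z) (l z)).
Proof.
move=> Ht Hl.
have H : tpt (fun z => filter (t z) (l z)) by apply: tpt_filter.
use (tpt_nonempty H); apply: tpt_ext => z.
by elim: (l z) => //= x s IH; case: (t z x).
Qed.

(** Lengths are compared without computing them: one element of [m z] is dropped per element of
    [l z], and something must remain. *)
Lemma tpt_size_lt {Z X Y : Type} {cZ : coded Z} {cX : coded X} {cY : coded Y}
    (l : Z -> seq X) (m : Z -> seq Y) :
  tpt l -> tpt m -> tpt (fun z => size (l z) < size (m z)).
Proof.
move=> Hl Hm.
use (@tpt_foldl Z (seq Y) X _ _ _ (fun z a x => behead a) l m 0).
move=> /(_ ltac:(tp) Hl Hm) H.
have foldE s t : foldl (fun a (_ : X) => behead a) t s = drop (size s) t :> seq Y.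
  by elim: s t => [|x s IH] [|y t] //=; rewrite IH.
have {}H : tpt (fun z => foldl (fun a (_ : X) => behead a) (m z) (l z)).
  by apply: H => z [|y a] x //; rewrite sz_cons /=; lia.
use (tpt_nonempty H); apply: tpt_ext => z.
by rewrite foldE -subn_gt0 -size_drop; case: (drop _ _).
Qed.

Lemma tpt_zip {Z X Y : Type} {cZ : coded Z} {cX : coded X} {cY : coded Y}
    (l : Z -> seq X) (m : Z -> seq Y) :
  tpt l -> tpt m -> tpt (fun z => zip (l z) (m z)).
Proof.
move=> Hl Hm.
pose g (z : Z) (a : seq Y * seq (X * Y)) (x : X) : seq Y * seq (X * Y) :=
  if a.1 is y :: s then (s, (x, y) :: a.2) else a.
use (@tpt_foldl Z _ X _ _ _ g l (fun z => (m z, [::])) 1).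
move=> /(_ _ Hl _ _) H.
have {H} H : tpt (fun z => foldl (g z) (m z, [::]) (l z)).
  apply: H => [||z [[|y s] a] x]; rewrite ?/g /=; [|tp| |].
  - apply: (@tpt_caseseq _ _ _ _ _ _ (fun p : Z * (seq Y * seq (X * Y) * X) => p.2.1.1) (fun p => p.2.1)
       (fun p y s => (s, (p.2.2, y) :: p.2.1.2))); tp.
  - exact: leq_addr.
  - by rewrite !sz_pair !sz_cons !sz_pair bnd1; lia.
use (tpt_rev (tpt_snd_of H)); apply: tpt_ext => z.
suff E s t a : (foldl (g z) (t, a) s).2 = catrev (zip s t) a by rewrite E -/(rev _) revK.
elim: s t a => [|x s IH] [|y t] a //=.
  by elim: s {IH}.
exact: IH.
Qed.

(** * Equality tests *)

Definition tpt_eqtype (X : eqType) {cX : coded X} := tpt (fun p : X * X => p.1 == p.2).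
Arguments tpt_eqtype X {cX}.

Lemma tpt_eq {Z : Type} {cZ : coded Z} (X : eqType) {cX : coded X} (f g : Z -> X) :
  tpt_eqtype X -> tpt f -> tpt g -> tpt (fun z => f z == g z).
Proof. by move=> H Hf Hg; apply: (tpt_comp (tpt_pair Hf Hg) H). Qed.

Lemma tpt_mem {Z : Type} {cZ : coded Z}
    (X : eqType) {cX : coded X} (x : Z -> X) (s : Z -> seq X) :
  tpt_eqtype X -> tpt x -> tpt s -> tpt (fun z => x z \in s z).
Proof.
move=> HX Hx Hs.
have H : tpt (fun z => has (fun y => y == x z) (s z)).
  apply: tpt_has => //; apply: (@tpt_comp _ _ _ _ _ _ (fun p => (p.2, x p.1)) _ _ HX).
  apply: tpt_pair; first exact: tpt_snd.
  by apply: tpt_comp tpt_fst Hx.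
by apply: tpt_ext H => z; rewrite -has_pred1.
Qed.

Lemma tpt_eq_bool : tpt_eqtype bool.
Proof. by apply: tpt_eqb; tp. Qed.

Lemma tpt_eq_pair (X Y : eqType) {cX : coded X} {cY : coded Y} :
  tpt_eqtype X -> tpt_eqtype Y -> tpt_eqtype (X * Y)%type.
Proof.
move=> HX HY.
have H : tpt (fun p : (X * Y) * (X * Y) => (p.1.1 == p.2.1) && (p.1.2 == p.2.2)).
  by apply: tpt_and; apply: tpt_eq => //; tp.
by apply: tpt_ext H => -[[? ?] [? ?]].
Qed.

Lemma tpt_eq_seq (X : eqType) {cX : coded X} : tpt_eqtype X -> tpt_eqtype (seq X).
Proof.
move=> HX; pose g (z : seq X * seq X) (a : bool * seq X) (x : X) : bool * seq X :=
  if a.2 is y :: s then (a.1 && (x == y), s) else (false, [::]).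
use (@tpt_foldl _ _ X _ _ _ g fst (fun z => (true, z.2)) 1).
move=> /(_ _ tpt_fst _ _) H.
have {H} H : tpt (fun z => foldl (g z) (true, z.2) z.1).
  apply: H => [||z [b [|y s]] x]; rewrite ?/g /=; [|tp| |].
  - apply: (@tpt_caseseq _ _ _ _ _ _ (fun p : seq X * seq X * (bool * seq X * X) => p.2.1.2)
      (fun p => (false, [::])) (fun p y s => (p.2.1.1 && (p.2.2 == y), s))); tp.
    by apply: tpt_eq => //; tp.
  - by rewrite !sz_pair bnd1 !sz_nil; use (sz_bool false); use (sz_gt0 b); lia.
  - by rewrite !sz_pair sz_cons bnd1; use (sz_bool (b && (x == y))); use (sz_gt0 b); lia.
have E z s t b : let r := foldl (g z) (b, t) s in
    r.1 && ~~ (if r.2 is x :: s then true else false) = b && (s == t).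
  elim: s t b => [|x s IH] [|y t] b //=; rewrite /g /= IH ?andbF //.
  by rewrite eqseq_cons andbA.
use (tpt_and (tpt_fst_of H) (tpt_neg (tpt_nonempty (tpt_snd_of H)))).
by apply: tpt_ext => z; rewrite E.
Qed.

(** * Bit strings and numbers *)

Lemma sz_bits (x : seq bool) : sz x <= 4 * size x + 1.
Proof. by elim: x => // b x IH; rewrite sz_cons /=; use (sz_bool b); lia. Qed.

Lemma size_bits (x : seq bool) : size x <= sz x.
Proof. by elim: x => // b x IH; rewrite sz_cons /=; lia. Qed.

(** From the top of the stack, the pushed bits are the list node and the code of [b]:
    [true, true, false, false] or [true, false]. *)
Definition PushItem (b : bool) : flow reg :=
  if b then Seq (Seq (Push rA false) (Push rA false)) (Seq (Push rA true) (Push rA true))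
  else Seq (Push rA false) (Push rA true).

(** Machines read raw strings, programs work on trees. The passage through [rB] reverses the input,
    so that the list can be built from its last item. *)
Definition RawIn : flow reg :=
  Seq (Drain rA (Push rB)) (Seq (Push rA false) (Drain rB PushItem)).

Definition RawOut : flow reg :=
  Seq (WhileT rA (Seq (Pop rA) (IfT rA (Seq (Pop rA) (Seq (Pop rA) (Seq (Pop rA) (Push rB true))))
                                       (Seq (Pop rA) (Push rB false)))))
  (Seq (Pop rA) (Drain rB (Push rA))).

Lemma runs_reverse r r' (x y : seq bool) s : r != r' -> get s r = x -> get s r' = y ->
  runs (Drain r (Push r')) s (5 * size x).+1 (set (set s r [::]) r' (catrev x y)).
Proof.
move=> rr' Hx Hy; split=> ts Hts.
pose P w (ts : tapes reg) := exists2 v, holds ts (set (set s r w) r' v) & catrev w v = catrev x y.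
have [| | |ts' E [v Hv Ev]] := @exec_Drain reg r (Push r') 2 P _ _ x ts.
- by move=> w ts1 [v ->]; rewrite !get_set eqxx (negPf rr').
- move=> b w ts1 [v Hv Ev].
  have [|H] := @runs_Pop r b (set (set s r (b :: w)) r' v) w.
    by rewrite !get_set eqxx (negPf rr').
  have {H} [ts2 E2 H2] := H _ Hv.
  have E2' := exec_Pop r ts1.
  (* Execution is deterministic, so the tapes obtained from the abstract pop are the concrete ones
     that [exec_Drain] hands to the body. *)
  have {E2 E2'} Ets : ts2 = upd ts1 r (tpop (ts1 r)) by move: E2; rewrite /exec E2' => -[].
  have [H3] := runs_Push r' b (set (set (set s r (b :: w)) r' v) r w).
  have [ts3 E3 Hs3] := H3 _ H2; exists ts3; first by rewrite -Ets.
  exists (b :: v) => //= r1; rewrite Hs3 !get_set eqxx (eq_sym r') (negPf rr').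
  by case: (r1 == r'); case: (r1 == r).
- exists y => // r1; rewrite Hts !get_set.
  by case: eqP => [->|_] //; case: eqP => [->|].
by exists ts'; rewrite // -Ev.
Qed.

Lemma runs_RawIn x :
  runs RawIn (x, [::], [::], [::]) (16 * size x + 4) (code (tc x), [::], [::], [::]).
Proof.
apply: (runs_le (n := (5 * size x).+1 + (2 + ((8 + 3) * size x).+1))); last by lia.
apply: runs_Seq; first exact: (@runs_reverse rA rB x [::] (x, [::], [::], [::])).
apply: runs_Seq (pushA _ _ _ _ _) _.
split=> ts Hts.
pose (P := fun (w : seq bool) (ts : tapes reg) => exists2 v, holds ts (code (tc v), w, [::], [::]) & catrev w v = x).
have [| | |ts' E [v Hv Ev]] := @exec_Drain reg rB PushItem 8 P _ _ (rev x) ts.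
- by move=> w ts1 [v -> _].
- move=> b w ts1 [v Hv Ev].
  have [H] := popB b (code (tc v)) w [::] [::].
  have {H} [ts2 E2 H2] := H _ Hv.
  have E2' := exec_Pop rB ts1.
  have {E2 E2'} Ets : ts2 = upd ts1 rB (tpop (ts1 rB)) by move: E2; rewrite /exec E2' => -[].
  have [H3] : runs (PushItem b) (code (tc v), w, [::], [::]) 8 (code (tc (b :: v)), w, [::], [::]).
    case: b {Hv Ev}.
      exact: runs_Seq (runs_Seq (pushA _ _ _ _ _) (pushA _ _ _ _ _))
               (runs_Seq (pushA _ _ _ _ _) (pushA _ _ _ _ _)).
    by apply: runs_le; first exact: runs_Seq (pushA _ _ _ _ _) (pushA _ _ _ _ _).
  have [ts3 E3 Hs3] := H3 _ H2; exists ts3; first by rewrite -Ets.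
  by exists (b :: v).
- by exists [::]; rewrite // -/(rev _) revK.
by exists ts'; [rewrite -(size_rev x) | rewrite -Ev].
Qed.

Lemma runs_RawOut y :
  runs RawOut (code (tc y), [::], [::], [::]) (13 * size y + 3) (y, [::], [::], [::]).
Proof.
apply: (runs_le (n := (8 * size y + 1) + (1 + (5 * size y).+1))); last by lia.
apply: (@runs_Seq _ _ _ _ ([:: false], rev y, [::], [::])).
  have E b : runs (WhileT rA (Seq (Pop rA) (IfT rA (Seq (Pop rA) (Seq (Pop rA) (Seq (Pop rA) (Push rB true))))
                                       (Seq (Pop rA) (Push rB false)))))
    (code (tc y), b, [::], [::]) (8 * size y + 1) ([:: false], catrev y b, [::], [::]); last exact: E.
  elim: y b => [|x y IHy] b; first exact: runs_stop.
  apply: (runs_le (n := ((1 + 6) + (8 * size y + 1)).+1)); last by rewrite /=; lia.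
  apply: (@runs_step _ _ _ _ (code (tc y), x :: b, [::], [::])) => //.
  apply: (@runs_Seq _ _ _ _ (code (tc x) ++ code (tc y), b, [::], [::])); first exact: popA.
  apply: runs_IfT; case: x => /=.
    exact: runs_Seq (popA _ _ _ _ _) (runs_Seq (popA _ _ _ _ _) (runs_Seq (popA _ _ _ _ _) (pushB _ _ _ _ _))).
  by apply: runs_le; first exact: runs_Seq (popA _ _ _ _ _) (pushB _ _ _ _ _).
apply: runs_Seq (popA _ _ _ _ _) _.
have := @runs_reverse rB rA (rev y) [::] ([::], rev y, [::], [::]) isT erefl erefl.
by rewrite /= -/(rev _) revK size_rev.
Qed.

(** Bounds in tree size turn into bounds in string length because a string of length [n] has a tree
    of size at most [4 * n + 1]. *)
Lemma tpt_polytime (f : seq bool -> seq bool) : tpt f -> polytime f.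
Proof.
move=> [P [k Hk]]; apply/polytimeP.
exists (flow_TM (Seq (Seq RawIn P) RawOut) rA rA).
have [m Hm] : PB (fun n => 16 * n + 4 + bnd k (4 * n + 1) + (13 * bnd k (4 * n + 1) + 3)) by pb.
exists m => x; have [H1 H2] := Hk x.
have {}H2 := H2 [::] [::] [::] [::]; rewrite !cats0 in H2.
have [H] := runs_Seq (runs_Seq (runs_RawIn x) H2) (runs_RawOut (f x)).
have [|ts' E Hts'] := H (init rA x).
  move=> r; rewrite ffunE; case: eqP => [->|]; first by rewrite val_input.
  by case: r => [[] []].
exists (16 * size x + 4 + bnd k (sz x) + (13 * size (f x) + 3)).
  apply: leq_trans (Hm _); have := bnd_mono k (sz_bits x) => H3.
  have H4 := size_bits (f x).
  by move: H1 H3 H4; rewrite /id; lia.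
have := flow_TM_outputs rA E; by rewrite Hts'.
Qed.

Ltac tp_eq := first [exact: tpt_eq_bool | apply: tpt_eq_seq; tp_eq | apply: tpt_eq_pair; tp_eq].

Ltac tp ::= cbv beta; first [ eassumption | lazymatch goal with
  | H : tpt ?h |- tpt (fun z => ?h (@?e z)) => apply (tpt_comp (f := e) (g := h)); [tp | exact H]
  | |- tpt (fun _ => ?c) => exact (tpt_const c)
  | |- tpt (fun z => z) => exact tpt_id
  | |- tpt fst => exact tpt_fst
  | |- tpt snd => exact tpt_snd
  | |- tpt (fun z => fst (@?f z)) => apply (tpt_fst_of (f := f)); tp
  | |- tpt (fun z => snd (@?f z)) => apply (tpt_snd_of (f := f)); tp
  | |- tpt (fun z => pair (@?f z) (@?g z)) => apply (tpt_pair (f := f) (g := g)); tp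
  | |- tpt (fun z => cons (@?f z) (@?g z)) => apply (tpt_cons (f := f) (g := g)); tp
  | |- tpt (fun z => andb (@?f z) (@?g z)) => apply (tpt_and (f := f) (g := g)); tp
  | |- tpt (fun z => orb (@?f z) (@?g z)) => apply (tpt_or (f := f) (g := g)); tp
  | |- tpt (fun z => negb (@?f z)) => apply (tpt_neg (f := f)); tp
  | |- tpt (fun z => behead (@?f z)) => apply (tpt_behead (l := f)); tp
  | |- tpt (fun z => rev (@?f z)) => apply (tpt_rev (f := f)); tp
  | |- tpt (fun z => cat (@?f z) (@?g z)) => apply (tpt_cat (f := f) (g := g)); tp
  | |- tpt (fun z => zip (@?f z) (@?g z)) => apply (tpt_zip (l := f) (m := g)); tp
  | |- tpt (fun z => flatten (@?f z)) => apply (tpt_flatten (l := f)); tp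
  | |- tpt (fun z => map (@?g z) (@?f z)) => apply (tpt_map (g := g) (l := f)); tp
  | |- tpt (fun z => filter (@?g z) (@?f z)) => apply (tpt_filter (t := g) (l := f)); tp
  | |- tpt (fun z => all (@?g z) (@?f z)) => apply (tpt_all (t := g) (l := f)); tp
  | |- tpt (fun z => has (@?g z) (@?f z)) => apply (tpt_has (t := g) (l := f)); tp
  | |- tpt (fun z => size (@?g z) < size (@?f z)) => apply (tpt_size_lt (l := g) (m := f)); tp
  | |- tpt (fun z => @?g z == @?f z) => apply (tpt_eq (f := g) (g := f)); tp
  | |- tpt (fun z => @?g z \in @?f z) => apply (tpt_mem (x := g) (s := f)); tp
  | |- tpt_eqtype _ => tp_eq
  | |- tpt (fun z => match _ with _ => _ end) => apply tpt_if; tp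
  | _ => idtac end ].

Lemma tpt_eq_seqbool : tpt_eqtype (seq bool).
Proof. tp. Qed.

(** * Binary numerals *)

Definition bits_nat (s : seq bool) : nat := foldr (fun (b : bool) n => b + n.*2) 0 s.

Lemma pos_bitsK p : bits_nat (pos_bits p) = nat_of_pos p.
Proof.
elim: p => [p IHp|p IHp|] //=; rewrite -/(bits_nat _) IHp.
  by rewrite NatTrec.doubleE.
by rewrite NatTrec.doubleE.
Qed.

Lemma nat_bitsK : cancel nat_bits bits_nat.
Proof.
move=> n; rewrite /nat_bits -{2}[n]bin_of_natK; case: (bin_of_nat n) => //= p.
exact: pos_bitsK.
Qed.

Lemma nat_bits_pos p : nat_bits (nat_of_pos p) = pos_bits p.
Proof. by rewrite /nat_bits -[nat_of_pos p]/(nat_of_bin (Npos p)) nat_of_binK. Qed.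

Lemma nat_of_pos_gt0 p : 0 < nat_of_pos p.
Proof. by elim: p => //= p IHp; rewrite NatTrec.doubleE // double_gt0. Qed.

Lemma nat_bits_double (b : bool) n :
  nat_bits (b + n.*2) = if b || (n != 0) then b :: nat_bits n else [::].
Proof.
have [->|[p ->]] : n = 0 \/ exists p, n = nat_of_pos p.
- by rewrite -[n]bin_of_natK; case: (bin_of_nat n) => [|p]; [left | right; exists p].
- by case: b.
have -> : nat_of_pos p != 0 by rewrite -lt0n nat_of_pos_gt0.
rewrite orbT nat_bits_pos; case: b.
  have -> : true + (nat_of_pos p).*2 = nat_of_pos (xI p) by rewrite /= NatTrec.doubleE.
  by rewrite nat_bits_pos.
have -> : false + (nat_of_pos p).*2 = nat_of_pos (xO p) by rewrite /= NatTrec.doubleE.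
by rewrite nat_bits_pos.
Qed.

Lemma sz_nat (n : nat) : sz n = sz (nat_bits n).
Proof. by []. Qed.

Lemma tpt_nat_bits : tpt nat_bits.
Proof. exact: tpt_cast. Qed.

Lemma nat_bits_inj : injective nat_bits.
Proof. exact: can_inj nat_bitsK. Qed.

Lemma tpt_eq_nat : tpt_eqtype nat.
Proof.
have H : tpt (fun p : nat * nat => nat_bits p.1 == nat_bits p.2).
  by apply: tpt_eq; [exact: tpt_eq_seqbool|apply: tpt_comp tpt_nat_bits; tp..].
by apply: tpt_ext H => -[m n]; rewrite (inj_eq nat_bits_inj).
Qed.

Ltac tp_eq ::= first [exact: tpt_eq_bool | exact: tpt_eq_nat | apply: tpt_eq_seq; tp_eq | apply: tpt_eq_pair; tp_eq].

Lemma tpt_bits_nat : tpt bits_nat.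
Proof.
pose g (z : seq bool) (n : nat) (b : bool) : nat := b + n.*2.
have H : tpt (fun z => foldl (g z) 0 (rev z)).
  apply: (@tpt_foldl _ _ _ _ _ _ g rev (fun=> 0) 1); [|exact: tpt_rev tpt_id|exact: tpt_const|].
    pose t (p : seq bool * (nat * bool)) := if p.2.2 || (nat_bits p.2.1 != [::]) then p.2.2 :: nat_bits p.2.1 else [::].
    have Ht : tpt t.
      have Hb : tpt (fun p : seq bool * (nat * bool) => nat_bits p.2.1).
        by apply: tpt_comp tpt_nat_bits; tp.
      by rewrite /t; tp.
    apply: tpt_retype Ht => -[z [n b]]; rewrite /t /= /g.
    rewrite /tc /coded_nat nat_bits_double -(inj_eq nat_bits_inj) /=; by case: ifP.
  move=> z n b; rewrite (sz_nat (g z n b)) (sz_nat n) /g nat_bits_double bnd1.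
  by case: ifP => _; rewrite ?sz_cons ?sz_nil; lia.
by apply: tpt_ext H => z; rewrite foldl_rev.
Qed.

(** * Parsing and the reduction *)

(* Compares binary numerals from the least significant bit on; the flag tells whether
   the part read so far of the first one is smaller. *)
Definition lt_step (a : seq bool * bool) (y : bool) : seq bool * bool :=
  if a.1 is x :: w then (w, if x == y then a.2 else y) else ([::], a.2 || y).

Lemma all_negb_bits w : all negb w = (bits_nat w == 0).
Proof. by elim: w => //= b w ->; rewrite -/(bits_nat w); case: b => //=; rewrite double_eq0. Qed.

(** Read the flag as a number [c] and compare [u < v + c]. For [u = x + 2 * u1] and [v = y + 2 * v1]
    this amounts to [u1 < v1 + c1], where [c1] is [c] if [x = y] and [y] otherwise. Digits left over
    in the first numeral must all be zero. *)
Lemma lt_stepP w w' c :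
  let a := foldl lt_step (w, c) w' in
  a.2 && all negb a.1 = (bits_nat w < bits_nat w' + c).
Proof.
elim: w' w c => [|y w' IH] w c /=.
  by rewrite all_negb_bits add0n; case: (bits_nat w) => [|n]; case: c.
case: w => [|x w]; rewrite /lt_step /= IH -!/(bits_nat _) /=.
  by case: y; case: c => /=; lia.
by case: x; case: y; case: c => /=; lia.
Qed.

Lemma tpt_ltn {Z : Type} {cZ : coded Z} (f g : Z -> nat) :
  tpt f -> tpt g -> tpt (fun z => f z < g z).
Proof.
move=> Hf Hg.
have Hbf : tpt (fun z => nat_bits (f z)) by apply: tpt_comp tpt_nat_bits.
have Hbg : tpt (fun z => nat_bits (g z)) by apply: tpt_comp tpt_nat_bits.
have H : tpt (fun z => foldl lt_step (nat_bits (f z), false) (nat_bits (g z))).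
  apply: (@tpt_foldl _ _ _ _ _ _ (fun=> lt_step) _ _ 1); [|tp|tp|].
    apply: (@tpt_caseseq _ _ _ _ _ _ (fun p : Z * (seq bool * bool * bool) => p.2.1.1)
      (fun p => ([::], p.2.1.2 || p.2.2))
      (fun p x w => (w, if x == p.2.2 then p.2.1.2 else p.2.2))); tp.
  move=> z [[|x w] c] y; rewrite /lt_step !sz_pair bnd1 /= ?sz_cons.
    by use (sz_bool (c || y)); use (sz_gt0 c); use (sz_gt0 y); lia.
  by use (sz_bool (if x == y then c else y)); use (sz_gt0 c); use (sz_gt0 y); lia.
have {}H : tpt (fun z => (foldl lt_step (nat_bits (f z), false) (nat_bits (g z))).2 &&
  all negb (foldl lt_step (nat_bits (f z), false) (nat_bits (g z))).1) by tp.
by apply: tpt_ext H => z; rewrite lt_stepP addn0 !nat_bitsK.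
Qed.

(** * Encoders and parsers *)

Lemma tpt_enc_seq {Z X : Type} {cZ : coded Z} {cX : coded X}
    (e : Z -> X -> seq bool) (l : Z -> seq X) :
  tpt (fun p : Z * X => e p.1 p.2) -> tpt l -> tpt (fun z => enc_seq (e z) (l z)).
Proof. by move=> He Hl; rewrite /enc_seq; tp. Qed.

Lemma tpt_enc_pair {Z X Y : Type} {cZ : coded Z} {cX : coded X} {cY : coded Y}
    (e : Z -> X -> seq bool) (e' : Z -> Y -> seq bool) (f : Z -> X * Y) :
  tpt (fun p : Z * X => e p.1 p.2) -> tpt (fun p : Z * Y => e' p.1 p.2) -> tpt f ->
  tpt (fun z => enc_pair (e z) (e' z) (f z)).
Proof.
move=> He He' Hf; rewrite /enc_pair; apply: tpt_cat.
  by apply: (tpt_comp (f := fun z => (z, (f z).1)) _ He); tp.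
by apply: (tpt_comp (f := fun z => (z, (f z).2)) _ He'); tp.
Qed.

Lemma tpt_enc_string {Z : Type} {cZ : coded Z}
    (f : Z -> seq bool) : tpt f -> tpt (fun z => enc_string (f z)).
Proof. by move=> Hf; apply: tpt_enc_seq; tp. Qed.

Lemma tpt_enc_nat {Z : Type} {cZ : coded Z}
    (f : Z -> nat) : tpt f -> tpt (fun z => enc_nat (f z)).
Proof. by move=> Hf; apply: tpt_enc_string; apply: tpt_comp tpt_nat_bits. Qed.

(** The state consists of the unread input, the items read so far in reverse, and a flag for the end
    of the list. The last argument counts rounds: folding over the input itself provides enough of
    them, as each item takes at least its mark [true] and the list its final [false]. *)
Definition parse_step {X : Type}
    (pa : seq bool -> X * seq bool) (st : seq bool * seq X * bool) (_ : bool) :=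
  if st.2 then st else
  if st.1.1 is b :: r then
    if b then ((pa r).2, (pa r).1 :: st.1.2, false) else (r, st.1.2, true)
  else ([::], st.1.2, true).

Definition parse_seq {X : Type} pa (r : seq bool) : seq X * seq bool :=
  let st := foldl (parse_step pa) (r, [::], false) r in (rev st.1.2, st.1.1).

Definition decodes {X : Type}
    (pa : seq bool -> X * seq bool) (enc : X -> seq bool) :=
  forall a r, pa (enc a ++ r) = (a, r).

(* The potential argument for the nested parsers: reading an item of a list consumes
   a bit [true], of size 4 in a list, which pays for the slack 3 and for the new node. *)
Definition frugal {X : Type} {cX : coded X} (pa : seq bool -> X * seq bool) k :=
  forall r, sz (pa r).1 + sz (pa r).2 <= sz r + k.

Lemma parse_seqK {X : Type} (pa : seq bool -> X * seq bool) enc :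
  decodes pa enc -> decodes (parse_seq pa) (enc_seq enc).
Proof.
move=> Hpa s r; rewrite /parse_seq.
have done fuel st : foldl (parse_step pa) (st, true) fuel = (st, true).
  by elim: fuel.
have E fuel acc : size s < size fuel ->
    foldl (parse_step pa) (enc_seq enc s ++ r, acc, false) fuel = (r, catrev s acc, true).
  elim: s fuel acc => [|x s IH] [|b fuel] acc //= Hs; first by rewrite /parse_step /= done.
  rewrite /enc_seq /= -!catA -/(enc_seq enc s) /parse_step /= -/(parse_step pa).
  by rewrite (catA _ [:: false]) Hpa -/(enc_seq enc s) /= IH.
rewrite E /= ?revK //.
rewrite !size_cat; suff: size s <= size (flatten [seq true :: enc x | x <- s]) by rewrite /=; lia.
by elim: s {E} => //= x s IH; rewrite size_cat; lia.
Qed.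

Lemma parse_step_sz {X : Type} {cX : coded X}
    (pa : seq bool -> X * seq bool) st b : frugal pa 3 ->
  sz (parse_step pa st b).1.1 + sz (parse_step pa st b).1.2 <= sz st.1.1 + sz st.1.2.
Proof.
move=> Hpa; case: st => [[r acc] d]; rewrite /parse_step /=; case: d => //=.
case: r => [|[] r] //=; last by rewrite sz_cons; lia.
by rewrite !sz_cons; have := Hpa r; have -> : sz true = 3 by []; lia.
Qed.

Lemma parse_seq_frugal {X : Type} {cX : coded X}
    (pa : seq bool -> X * seq bool) : frugal pa 3 -> frugal (parse_seq pa) 1.
Proof.
move=> Hpa r; rewrite /parse_seq /= sz_rev.
have E fuel st : let st' := foldl (parse_step pa) st fuel in
    sz st'.1.1 + sz st'.1.2 <= sz st.1.1 + sz st.1.2.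
  elim: fuel st => [|b fuel IH] st //=; apply: leq_trans (IH _) _.
  exact: parse_step_sz.
by have := E r (r, [::], false); rewrite /= sz_nil; lia.
Qed.

Lemma tpt_parse_seq {X : Type} {cX : coded X}
    (pa : seq bool -> X * seq bool) : tpt pa -> frugal pa 3 -> tpt (parse_seq pa).
Proof.
move=> Ht Hpa; rewrite /parse_seq.
have H : tpt (fun r => foldl (parse_step pa) (r, [::], false) r).
  apply: (@tpt_foldl _ _ _ _ _ _ (fun=> parse_step pa) _ _ 1); [|tp|tp|].
    apply: tpt_if; [tp|tp|].
    apply: (@tpt_caseseq _ _ _ _ _ _
      (fun p : seq bool * (seq bool * seq X * bool * bool) => p.2.1.1.1)
      (fun p => ([::], p.2.1.1.2, true))
      (fun p b r => if b then ((pa r).2, (pa r).1 :: p.2.1.1.2, false) else (r, p.2.1.1.2, true))); [tp|tp|].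
    have H1 : tpt (fun p : (seq bool * (seq bool * seq X * bool * bool)) * (bool * seq bool) => pa p.2.2).
      by apply: tpt_comp Ht; tp.
    tp.
  move=> z st b; have := parse_step_sz st b Hpa.
  case: (parse_step pa st b) => [[r' a'] d']; case: st => [[r a] d] /=.
  by rewrite !sz_pair bnd1 => H; use (sz_bool d'); use (sz_gt0 d); use (sz_gt0 b); lia.
tp.
Qed.

Lemma frugal_le {X : Type} {cX : coded X}
    (pa : seq bool -> X * seq bool) k l : frugal pa k -> k <= l -> frugal pa l.
Proof. by move=> H le r; apply: leq_trans (H r) _; rewrite leq_add2l. Qed.

Definition parse_pair {X Y : Type}
    (pa : seq bool -> X * seq bool) (pb : seq bool -> Y * seq bool) (r : seq bool) : X * Y * seq bool :=
  ((pa r).1, (pb (pa r).2).1, (pb (pa r).2).2).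

Lemma parse_pairK {X Y : Type} (pa : seq bool -> X * seq bool) (pb : seq bool -> Y * seq bool)
    encA encB :
  decodes pa encA -> decodes pb encB -> decodes (parse_pair pa pb) (enc_pair encA encB).
Proof. by move=> HA HB [a b] r; rewrite /parse_pair /enc_pair -catA HA HB. Qed.

Lemma parse_pair_frugal {X Y : Type} {cX : coded X} {cY : coded Y}
    (pa : seq bool -> X * seq bool) (pb : seq bool -> Y * seq bool) k l :
  frugal pa k -> frugal pb l -> frugal (parse_pair pa pb) (k + l).+1.
Proof.
move=> HA HB r; rewrite /parse_pair /= sz_pair.
by have := HA r; have := HB (pa r).2; lia.
Qed.

Lemma tpt_parse_pair {X Y : Type} {cX : coded X} {cY : coded Y}
    (pa : seq bool -> X * seq bool) (pb : seq bool -> Y * seq bool) : tpt pa -> tpt pb -> tpt (parse_pair pa pb).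
Proof.
move=> HA HB; rewrite /parse_pair.
have H : tpt (fun r => pb (pa r).2) by apply: tpt_comp HB; tp.
tp.
Qed.

Definition parse_bit (r : seq bool) : bool * seq bool :=
  if r is b :: r' then (b, r') else (false, [::]).

Lemma parse_bit_frugal : frugal parse_bit 3.
Proof. by case=> [|b r]; rewrite /parse_bit /= ?sz_cons ?sz_nil; [use (sz_bool false)|]; lia. Qed.

Lemma tpt_parse_bit : tpt parse_bit.
Proof.
apply: (@tpt_caseseq _ _ _ _ _ _ (fun r : seq bool => r) (fun=> (false, [::]))
  (fun _ b r => (b, r))); tp.
Qed.

Definition parse_string := parse_seq parse_bit.

Lemma parse_stringK : decodes parse_string enc_string.
Proof. exact: parse_seqK. Qed.

Lemma parse_string_frugal : frugal parse_string 1.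
Proof. exact: parse_seq_frugal parse_bit_frugal. Qed.

Lemma tpt_parse_string : tpt parse_string.
Proof. exact: tpt_parse_seq tpt_parse_bit parse_bit_frugal. Qed.

Definition parse_nat (r : seq bool) : nat * seq bool :=
  (bits_nat (parse_string r).1, (parse_string r).2).

Lemma parse_natK : decodes parse_nat enc_nat.
Proof. by move=> n r; rewrite /parse_nat parse_stringK /= nat_bitsK. Qed.

Lemma sz_bits_nat w : sz (bits_nat w) <= sz w.
Proof.
elim: w => [|b w IH] //=; rewrite sz_nat nat_bits_double -/(bits_nat w).
case: ifP => _; last by rewrite sz_nil; exact: sz_gt0.
by rewrite !sz_cons ltnS leq_add2l -sz_nat.
Qed.

Lemma parse_nat_frugal : frugal parse_nat 1.
Proof.
move=> r; have := parse_string_frugal r; have := sz_bits_nat (parse_string r).1.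
by rewrite /parse_nat /=; lia.
Qed.

Lemma tpt_parse_nat : tpt parse_nat.
Proof.
have H := tpt_parse_string; rewrite /parse_nat.
have H1 : tpt (fun r => bits_nat (parse_string r).1) by apply: tpt_comp tpt_bits_nat; tp.
tp.
Qed.

Definition npair := (nat * nat)%type.
Definition enc_npair : npair -> seq bool := enc_pair enc_nat enc_nat.
Definition parse_npair := parse_pair parse_nat parse_nat.
Definition parse_npairs := parse_seq parse_npair.
Definition parse_npairss := parse_seq parse_npairs.

(** Each number contributes slack 1 and the pair node another 1, which is just the slack 3 allowed
    for an item of a list. *)
Lemma parse_npair_frugal : frugal parse_npair 3.
Proof. exact: parse_pair_frugal parse_nat_frugal parse_nat_frugal. Qed.

Lemma parse_npairs_frugal : frugal parse_npairs 3.
Proof. by apply: (@frugal_le _ _ _ 1) => //; apply: parse_seq_frugal parse_npair_frugal. Qed.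

Lemma tpt_parse_npairss : tpt parse_npairss.
Proof.
apply: tpt_parse_seq parse_npairs_frugal; apply: tpt_parse_seq parse_npair_frugal.
exact: tpt_parse_pair tpt_parse_nat tpt_parse_nat.
Qed.

Lemma parse_npairssK : decodes parse_npairss (enc_seq (enc_seq enc_npair)).
Proof. by do 2!apply: parse_seqK; apply: parse_pairK; apply: parse_natK. Qed.

Lemma tpt_parse_nats : tpt (parse_seq parse_nat).
Proof.
apply: tpt_parse_seq tpt_parse_nat _.
by apply: (@frugal_le _ _ _ 1) => //; apply: parse_nat_frugal.
Qed.

(* Candidates, orders and distinguished candidate of a possible winner instance. *)
Definition pw_data := (seq nat * (seq (seq npair) * nat))%type.

Definition enc_data (d : pw_data) : seq bool :=
  enc_seq enc_nat d.1 ++ enc_seq (enc_seq enc_npair) d.2.1 ++ enc_nat d.2.2.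

Definition parse_data (u : seq bool) : pw_data :=
  let c := parse_seq parse_nat u in
  let o := parse_npairss c.2 in
  (c.1, (o.1, (parse_nat o.2).1)).

Lemma parse_dataK d : parse_data (enc_data d) = d.
Proof.
case: d => C [O p]; rewrite /parse_data /enc_data (parse_seqK parse_natK).
by rewrite parse_npairssK -[enc_nat _]cats0 parse_natK.
Qed.

Lemma tpt_parse_data : tpt parse_data.
Proof.
have H1 := tpt_parse_nats; rewrite /parse_data.
have H2 : tpt (fun u => parse_npairss (parse_seq parse_nat u).2).
  by apply: tpt_comp tpt_parse_npairss; tp.
have H3 : tpt (fun u => parse_nat (parse_npairss (parse_seq parse_nat u).2).2).
  by apply: tpt_comp tpt_parse_nat; tp.
tp.
Qed.

(** * Validity of data, the reduction and the check *)

Definition pairs (C : seq nat) : seq npair := flatten [seq [seq (a, b) | b <- C] | a <- C].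

(** The first condition puts the pairs of [r] inside [C] and in the order in which [enc_order] lists
    them, so that only canonical encodings pass. *)
Definition poset_on (C : seq nat) (r : seq npair) : bool :=
  [&& r == [seq e <- pairs C | e \in r], all (fun e => ~~ (e.1 == e.2)) r &
      all (fun e => all (fun e' => ~~ (e.2 == e'.1) || ((e.1, e'.2) \in r)) r) r].

Definition valid_data (d : pw_data) : bool :=
  [&& all (fun e => e.1 < e.2) (zip d.1 (behead d.1)), d.2.2 \in d.1 &
      all (fun r => poset_on d.1 r) d.2.1].

(** The parsers are total and return something on any string; encoding the result again exposes the
    strings that are not encodings. *)
Definition valid (u : seq bool) : bool :=
  (enc_data (parse_data u) == u) && valid_data (parse_data u).

(* Comparing first the number of predecessors in [r] extends [r] to a linear order. *)
Definition lin_lt (r : seq npair) (e : npair) : bool :=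
  (size [seq x <- r | x.2 == e.1] < size [seq x <- r | x.2 == e.2]) ||
  (~~ (size [seq x <- r | x.2 == e.2] < size [seq x <- r | x.2 == e.1]) && (e.1 < e.2)).

Definition touches (r : seq npair) (e : npair) : bool := (e \in r) || ((e.2, e.1) \in r).

Definition enc_bribery_data (d : pw_data) : seq bool :=
  enc_seq enc_nat d.1 ++
  enc_seq (fun r => enc_seq enc_npair [seq e <- pairs d.1 | lin_lt r e]) d.2.1 ++
  enc_seq (fun r => enc_seq (enc_pair enc_npair enc_nat)
     [seq (e, if touches r e then 1 else 0) | e <- [seq e <- pairs d.1 | e.1 < e.2]]) d.2.1 ++
  enc_nat d.2.2.

(* Strings that encode no instance are mapped to this one, as the approximation
   algorithm need not halt on other inputs. *)
Definition trivial_data : pw_data := ([:: 0], ([::], 0)).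

Definition to_bribery (u : seq bool) : seq bool :=
  enc_bribery_data (if valid u then parse_data u else trivial_data).

(** With costs 0 and 1, a total of 0 can be recognised without any addition. *)
Definition cheap (O B : seq (seq npair)) : bool :=
  all (fun rs => all (fun s => ~~ touches rs.1 s) rs.2) (zip O B).

(** The first bit of [y] is the tag by which [enc_option] separates [Some] from [None]. Only the
    cost is inspected: that the swaps are allowed and make the candidate win is part of what the
    approximation machine guarantees. *)
Definition check_answer (v : seq bool) : bool :=
  let u := (parse_string v).1 in
  let y := (parse_string v).2 in
  [&& valid u, (if y is b :: _ then b else false) &
      cheap (parse_data u).2.1 (parse_npairss (behead y)).1].

(** * Polynomial time of the reduction and the check *)

Lemma tpt_pairs {Z : Type} {cZ : coded Z} (f : Z -> seq nat) : tpt f -> tpt (fun z => pairs (f z)).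
Proof. move=> Hf; rewrite /pairs; tp. Qed.

Lemma tpt_touches {Z : Type} {cZ : coded Z} (f : Z -> seq npair) (g : Z -> npair) :
  tpt f -> tpt g -> tpt (fun z => touches (f z) (g z)).
Proof. by move=> Hf Hg; rewrite /touches; tp. Qed.

Lemma tpt_enc_npair {Z : Type} {cZ : coded Z} (f : Z -> npair) :
  tpt f -> tpt (fun z => enc_npair (f z)).
Proof. by move=> Hf; apply: tpt_enc_pair => //; apply: tpt_enc_nat; tp. Qed.

Lemma tpt_enc_data {Z : Type} {cZ : coded Z} (f : Z -> pw_data) :
  tpt f -> tpt (fun z => enc_data (f z)).
Proof.
move=> Hf; rewrite /enc_data; apply: tpt_cat; [|apply: tpt_cat; [|by apply: tpt_enc_nat; tp]];
  apply: tpt_enc_seq; try by tp.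
  by apply: tpt_enc_nat; tp.
by apply: tpt_enc_seq; [apply: tpt_enc_npair; tp | tp].
Qed.

Lemma tpt_poset_on {Z : Type} {cZ : coded Z} (C : Z -> seq nat) (r : Z -> seq npair) :
  tpt C -> tpt r -> tpt (fun z => poset_on (C z) (r z)).
Proof.
move=> HC Hr; rewrite /poset_on; have HP := tpt_pairs HC.
have Hr1 (W : Type) (cW : coded W) : tpt (fun p : Z * W => r p.1) by apply: tpt_comp tpt_fst Hr.
have Hr2 : tpt (fun p : Z * npair * npair => r p.1.1) by apply: tpt_comp Hr; tp.
have Hr3 := Hr1 npair _.
tp.
Qed.

Lemma tpt_valid : tpt valid.
Proof.
have HP := tpt_parse_data; rewrite /valid; have HE := tpt_enc_data HP.
apply: tpt_and; first by tp.
rewrite /valid_data; do !apply: tpt_and; try by tp.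
  by apply: tpt_all; [apply: tpt_ltn; tp | tp].
apply: tpt_all; last by tp.
have H1 : tpt (fun p : seq bool * seq npair => parse_data p.1) by apply: tpt_comp HP; tp.
by apply: tpt_poset_on; tp.
Qed.

Lemma tpt_lin_lt {Z : Type} {cZ : coded Z} (f : Z -> seq npair) (g : Z -> npair) :
  tpt f -> tpt g -> tpt (fun z => lin_lt (f z) (g z)).
Proof.
move=> Hf Hg; rewrite /lin_lt.
have Hg1 : tpt (fun p : Z * npair => g p.1) by apply: tpt_comp Hg; tp.
apply: tpt_or; first by tp.
apply: tpt_and; first by tp.
by apply: tpt_ltn; tp.
Qed.

Lemma tpt_to_bribery : tpt to_bribery.
Proof.
have Hd : tpt (fun u => if valid u then parse_data u else trivial_data).
  by apply: tpt_if; [exact: tpt_valid | exact: tpt_parse_data | tp].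
rewrite /to_bribery; have H : tpt enc_bribery_data; last exact: tpt_comp Hd H.
rewrite /enc_bribery_data; apply: tpt_cat; [|apply: tpt_cat; [|apply: tpt_cat; [|by apply: tpt_enc_nat; tp]]];
  apply: tpt_enc_seq; try by tp.
- by apply: tpt_enc_nat; tp.
- apply: tpt_enc_seq; first by apply: tpt_enc_npair; tp.
  apply: tpt_filter; last by apply: tpt_pairs; tp.
  by apply: tpt_lin_lt; tp.
apply: tpt_enc_seq.
  by apply: tpt_enc_pair; [apply: tpt_enc_npair; tp | apply: tpt_enc_nat; tp | tp].
apply: tpt_map.
  have H : tpt (fun p : (pw_data * seq npair) * npair => touches p.1.2 p.2) by apply: tpt_touches; tp.
  by tp.
apply: tpt_filter; first by apply: tpt_ltn; tp.
by apply: tpt_pairs; tp.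
Qed.

Lemma tpt_check_answer : tpt check_answer.
Proof.
have H1 := tpt_parse_string; rewrite /check_answer.
apply: tpt_and; first by apply: tpt_comp tpt_valid; tp.
apply: tpt_and.
  by apply: (@tpt_caseseq _ _ _ _ _ _ (fun v => (parse_string v).2) (fun=> false) (fun _ b _ => b)); tp.
rewrite /cheap; apply: tpt_all.
  by apply: tpt_all; [apply: tpt_neg; apply: tpt_touches; tp | tp].
have H2 : tpt (fun v => parse_data (parse_string v).1) by apply: tpt_comp tpt_parse_data; tp.
have H3 : tpt (fun v => parse_npairss (behead (parse_string v).2)) by apply: tpt_comp tpt_parse_npairss; tp.
tp.
Qed.

Local Open Scope fset_scope.

(** * Instances and their data *)

Definition pw_of (d : pw_data) : pw_instance :=
  PWInstance [fset c in d.1] [seq [fset e in r] | r <- d.2.1] d.2.2.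

Definition lin_order (C : seq nat) (r : seq npair) : Defs.order :=
  [fset e in [seq e <- pairs C | lin_lt r e]].

Definition unit_cost (r : seq npair) : swap_cost :=
  fun S => has (fun e => [fset e.1; e.2] == S) r.

Definition sb_of (d : pw_data) : sb_instance :=
  SBInstance (Election [fset c in d.1] [seq lin_order d.1 r | r <- d.2.1])
    [seq unit_cost r | r <- d.2.1] d.2.2.

Lemma sorted_zip (s : seq nat) :
  all (fun e => e.1 < e.2) (zip s (behead s)) = sorted ltn s.
Proof.
case: s => //= x s; elim: s x => //= y s IH x; by rewrite IH.
Qed.

Lemma sort_fset_seq (C : seq nat) : sorted ltn C -> sort leq (enum_fset [fset c in C]) = C.
Proof.
move=> sC; apply: (sorted_eq leq_trans anti_leq).
- exact: (sort_sorted leq_total).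
- by apply: sub_sorted sC => x y; apply: ltnW.
rewrite perm_sort; apply: uniq_perm; first exact: fset_uniq.
  exact: (sorted_uniq ltn_trans ltnn).
by move=> c; rewrite -/(c \in [fset c in C]) inE.
Qed.

Lemma mem_pairs C a b : ((a, b) \in pairs C) = (a \in C) && (b \in C).
Proof.
apply/allpairsP/andP => [[[x y] /= [Hx Hy [-> ->]]] //|[Ha Hb]].
by exists (a, b).
Qed.

Lemma pairs_uniq C : uniq C -> uniq (pairs C).
Proof. by move=> uC; apply: allpairs_uniq => // -[? ?] [? ?]. Qed.

Lemma enc_cands_seq (C : seq nat) : sorted ltn C -> enc_cands [fset c in C] = enc_seq enc_nat C.
Proof. by move=> sC; rewrite /enc_cands sort_fset_seq. Qed.

Lemma enc_order_seq (C : seq nat) (P : pred npair) (r : Defs.order) : sorted ltn C ->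
  {in pairs C, forall e, (e \in r) = P e} ->
  enc_order [fset c in C] r = enc_seq enc_npair [seq e <- pairs C | P e].
Proof.
move=> sC H; rewrite /enc_order sort_fset_seq //; congr enc_seq.
exact: eq_in_filter.
Qed.

Lemma poset_onP C r : reflect
  [/\ r = [seq e <- pairs C | e \in r], forall a, (a, a) \notin r &
      forall a b c, (a, b) \in r -> (b, c) \in r -> (a, c) \in r] (poset_on C r).
Proof.
apply: (iffP and3P) => -[H1 H2 H3]; split.
- exact/eqP.
- by move=> a; apply/negP => /(allP H2); rewrite eqxx.
- move=> a b c Hab Hbc; have := allP (allP H3 _ Hab) _ Hbc.
  by rewrite /= eqxx.
- exact/eqP.
- by apply/allP => -[a b] Hab /=; apply/negP => /eqP E; have := H2 b; rewrite -{1}E Hab.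
- apply/allP => -[a b] Hab; apply/allP => -[b' c] Hbc /=.
  by case: eqP => //= E; apply: H3 Hab _; rewrite E.
Qed.

Lemma poset_on_sub C r a b : poset_on C r -> (a, b) \in r -> (a \in C) && (b \in C).
Proof. by move=> /poset_onP[-> _ _]; rewrite mem_filter mem_pairs => /andP[]. Qed.

Lemma poset_on_strict C r : poset_on C r -> strict_partial_order [fset c in C] [fset e in r].
Proof.
move=> Hr; have /poset_onP[_ H2 H3] := Hr; split.
- apply/fsubsetP => -[a b]; rewrite !inE /=; exact: poset_on_sub.
- by move=> a; rewrite !inE.
- by move=> a b c; rewrite !inE; apply: H3.
Qed.

Lemma strict_poset_on (C : {fset nat}) (r : Defs.order) : strict_partial_order C r ->
  let s := sort leq (enum_fset C) in
  poset_on s [seq e <- pairs s | e \in r] /\ [fset e in [seq e <- pairs s | e \in r]] = r.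
Proof.
move=> [H1 H2 H3] s.
have mem_s a : (a \in s) = (a \in C) by rewrite mem_sort.
have memr e : (e \in [seq e <- pairs s | e \in r]) = (e \in r).
  case: e => a b; rewrite mem_filter mem_pairs !mem_s andb_idr //.
  by move/(fsubsetP H1); rewrite !inE.
split; last by apply/fsetP => e; rewrite !inE memr.
apply/poset_onP; split.
- by apply: eq_filter => e; rewrite memr.
- by move=> a; rewrite memr.
- by move=> a b c; rewrite !memr; apply: H3.
Qed.

Lemma valid_pw_of d : valid_data d -> pw_wf (pw_of d) /\ enc_pw (pw_of d) = enc_data d.
Proof.
case: d => C [O p] /and3P [/= sC Hp HO]; rewrite sorted_zip in sC; split.
  split; last by rewrite !inE.
  by move=> r /mapP[s Hs ->]; apply: poset_on_strict (allP HO _ Hs).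
rewrite /enc_pw /enc_data /= enc_cands_seq //; congr (_ ++ (_ ++ _)).
rewrite /enc_seq; congr (flatten _ ++ _); rewrite -map_comp; apply/eq_in_map => r Hr /=.
congr (_ :: _); have /poset_onP[E _ _] := allP HO _ Hr.
rewrite (@enc_order_seq _ (fun e => e \in r)) // -?E // => e _.
by rewrite !inE.
Qed.

Lemma pw_of_valid I : pw_wf I -> exists2 d, valid_data d & pw_of d = I.
Proof.
case: I => C O p [/= HO Hp]; pose s := sort leq (enum_fset C).
exists (s, ([seq [seq e <- pairs s | e \in r] | r <- O], p)).
  apply/and3P; split => /=.
  - rewrite sorted_zip ltn_sorted_uniq_leq sort_uniq fset_uniq.
    exact: (sort_sorted leq_total).
  - by rewrite mem_sort.
  - elim: O HO => //= r O IH HO; rewrite IH => [|r' Hr']; last by apply: HO; rewrite inE Hr' orbT.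
    by rewrite andbT; case: (strict_poset_on (HO r (mem_head _ _))).
rewrite /pw_of /=; congr PWInstance.
  by apply/fsetP => c; rewrite !inE mem_sort.
elim: O HO => //= r O IH HO; rewrite IH => [|r' Hr']; last by apply: HO; rewrite inE Hr' orbT.
by case: (strict_poset_on (HO r (mem_head _ _))) => _ ->.
Qed.

Lemma valid_enc d : valid_data d -> valid (enc_data d).
Proof. by move=> Hd; rewrite /valid parse_dataK eqxx. Qed.

Lemma possible_winnerP R u : possible_winner R u <->
  valid u /\ is_possible_winner R (pw_of (parse_data u)).
Proof.
split=> [[I [/pw_of_valid [d Hd <-] -> HI]]|[/andP[/eqP Eu Hd] H]].
  have [_ ->] := valid_pw_of Hd; by rewrite valid_enc // parse_dataK.
have [Hwf E] := valid_pw_of Hd.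
by exists (pw_of (parse_data u)); split=> //; rewrite E Eu.
Qed.

(** * Linear extensions and unit costs *)

Lemma lin_order_linear C r : strict_linear_order [fset c in C] (lin_order C r).
Proof.
have memL a b : ((a, b) \in lin_order C r) = [&& lin_lt r (a, b), a \in C & b \in C].
  by rewrite !inE mem_filter mem_pairs.
split; first split.
- by apply/fsubsetP => -[a b]; rewrite memL !inE => /and3P[_ -> ->].
- by move=> a; rewrite memL /lin_lt /= !ltnn.
- move=> a b c; rewrite !memL /lin_lt /= => /and3P[H1 -> _] /and3P[H2 _ ->].
  by rewrite !andbT; move: H1 H2; lia.
move=> a b Ha Hb; rewrite !memL /lin_lt /=; move: Ha Hb; rewrite !inE => -> -> /=; lia.
Qed.

(** For [e = (a, b)], transitivity makes every predecessor of [a] a predecessor of [b], and [a]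
    itself is one that by irreflexivity does not precede [a]. Hence [b] has strictly more
    predecessors. *)
Lemma lin_lt_extends C r e : uniq C -> poset_on C r -> e \in r -> lin_lt r e.
Proof.
case: e => a b uC Hr Hab; have /poset_onP[E H2 H3] := Hr.
have ur : uniq r by rewrite E filter_uniq // pairs_uniq.
apply/orP; left => /=.
rewrite -(size_map fst) -[X in _ < X](size_map fst) -/(size (a :: _)).
apply: uniq_leq_size.
  rewrite /= map_inj_in_uniq ?filter_uniq // ?andbT.
    by apply/mapP => -[[x y]]; rewrite mem_filter /= => /andP[/eqP -> H] Ex; have := H2 a; rewrite {1}Ex H.
  by move=> [x y] [x' y']; rewrite !mem_filter /= => /andP[/eqP -> _] /andP[/eqP -> _] ->.
move=> x; rewrite inE => /orP[/eqP ->|/mapP[[x' y]]].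
  by apply/mapP; exists (a, b) => //; rewrite mem_filter /= eqxx.
rewrite mem_filter /= => /andP[/eqP -> H] ->.
by apply/mapP; exists (x', b) => //; rewrite mem_filter /= eqxx; apply: H3 Hab.
Qed.

Lemma lin_order_extends C r : uniq C -> poset_on C r -> [fset e in r] `<=` lin_order C r.
Proof.
move=> uC Hr; apply/fsubsetP => -[a b]; rewrite !inE => H.
rewrite mem_filter mem_pairs (poset_on_sub Hr H) (lin_lt_extends uC Hr H) //.
Qed.

Lemma pair_fset (T : choiceType) (a b x y : T) :
  ([fset a; b] == [fset x; y]) = ((a, b) == (x, y)) || ((b, a) == (x, y)).
Proof.
apply/eqP/orP => [E|[|] /eqP[-> ->] //]; last by rewrite fsetUC.
have Ha : a \in [fset x; y] by rewrite -E !inE eqxx.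
have Hb : b \in [fset x; y] by rewrite -E !inE eqxx orbT.
have Hx : x \in [fset a; b] by rewrite E !inE eqxx.
have Hy : y \in [fset a; b] by rewrite E !inE eqxx orbT.
move: Ha Hb Hx Hy; rewrite !inE.
move=> /orP[] /eqP -> /orP[] /eqP ->; rewrite ?eqxx ?orbb; try by [left | right].
- by move=> _ /eqP ->; left.
- by move=> /eqP -> _; left.
Qed.

Lemma unit_costE r a b : unit_cost r [fset a; b] = touches r (a, b).
Proof.
rewrite /unit_cost /touches; congr nat_of_bool; apply/hasP/orP => /=.
  move=> [[x y] Hr]; rewrite pair_fset => /orP[/eqP [<- <-]|/eqP [<- <-]]; by [left | right].
by case=> H; [exists (a, b) | exists (b, a)]; rewrite // pair_fset eqxx ?orbT.
Qed.

Lemma sb_of_wf d : valid_data d -> sb_wf (sb_of d).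
Proof.
case: d => C [O p] /and3P [/= sC Hp HO]; split=> /=.
- by move=> v /mapP[r _ ->]; apply: lin_order_linear.
- by rewrite !size_map.
- by rewrite !inE.
Qed.

Lemma enc_sb_of d : valid_data d -> enc_sb (sb_of d) = enc_bribery_data d.
Proof.
case: d => C [O p] /and3P [/= sC Hp HO]; rewrite sorted_zip in sC.
rewrite /enc_sb /enc_bribery_data /= enc_cands_seq //; congr (_ ++ (_ ++ (_ ++ _))).
  rewrite /enc_seq; congr (flatten _ ++ _); rewrite -map_comp; apply/eq_in_map => r Hr /=.
  congr (_ :: _); apply: enc_order_seq => // e He.
  by rewrite !inE mem_filter He andbT.
rewrite /enc_seq; congr (flatten _ ++ _); rewrite -map_comp; apply/eq_in_map => r Hr /=.
congr (_ :: _); rewrite /enc_cost sort_fset_seq // /enc_seq; congr (flatten (map _ _) ++ _).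
by apply: eq_map => -[a b]; rewrite unit_costE; case: touches.
Qed.

Lemma to_bribery_enc u :
  exists2 d, valid_data d & to_bribery u = enc_sb (sb_of d) /\ (valid u -> d = parse_data u).
Proof.
rewrite /to_bribery; case: (boolP (valid u)) => Hu.
  have /andP[_ Hd] := Hu; exists (parse_data u) => //.
  by rewrite enc_sb_of.
by exists trivial_data; rewrite ?enc_sb_of.
Qed.

(** * Swapping adjacent candidates *)

Lemma ltn_card_fset (T : choiceType) (A B : {fset T}) x :
  {subset A <= B} -> x \in B -> x \notin A -> #|` A| < #|` B|.
Proof.
move=> sub HB HA; apply: fproper_ltn_card; rewrite fproperE; apply/andP; split.
  exact/fsubsetP.
by apply/fsubsetPn; exists x.
Qed.

Lemma mem_do_swap v s e : (e \in do_swap v s) = (e == (s.2, s.1)) || (e != s) && (e \in v).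
Proof. by rewrite /do_swap in_fset1U in_fsetD1. Qed.

Lemma linear_asym C v a b : strict_linear_order C v -> (a, b) \in v -> (b, a) \notin v.
Proof.
by move=> [[_ irr tr] _] H; apply/negP => H'; have := irr a; rewrite (tr _ _ _ H H').
Qed.

Lemma linear_cands C v a b : strict_linear_order C v -> (a, b) \in v -> a \in C /\ b \in C.
Proof. by move=> [[sub _ _] _] /(fsubsetP sub); rewrite !inE => /andP. Qed.

Lemma linear_total C v a b : strict_linear_order C v -> a \in C -> b \in C -> a != b ->
  (a, b) \notin v -> (b, a) \in v.
Proof. by move=> [_ tot] Ha Hb ne; move: (tot a b Ha Hb ne) => /orP[->|->]. Qed.

(** Transitivity is the point. If a chain using the new pair [(y, x)] failed to compose, or a chain
    of old pairs composed to the removed pair [(x, y)], then some candidate would lie between [x]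
    and [y], which adjacency excludes. *)
Lemma do_swap_linear C v s :
  strict_linear_order C v -> swap_allowed v s -> strict_linear_order C (do_swap v s).
Proof.
case: s => x y lin [/= Hxy adj].
have [[sub irr tr] tot] := lin; have [Hx Hy] := linear_cands lin Hxy.
have ne : x != y by apply: contraTneq Hxy => ->; apply: irr.
have ne' : (y == x) = false by rewrite eq_sym (negPf ne).
split; first split.
- apply/fsubsetP => e; rewrite mem_do_swap /= => /orP[/eqP ->|/andP[_]]; last exact: (fsubsetP sub).
  by rewrite !inE Hx Hy.
- move=> a; rewrite mem_do_swap /= (negPf (irr a)) andbF orbF xpair_eqE.
  by apply: contraNN ne => /andP[/eqP <- /eqP <-].
- move=> a b c; rewrite !mem_do_swap /= !xpair_eqE.
  move=> /orP[/andP[/eqP -> /eqP ->]|/andP[nab Hab]] /orP[/andP[/eqP Eb /eqP Ec]|/andP[nbc Hbc]].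
  + by rewrite Eb eqxx in ne.
  + rewrite eqxx /= in nbc; rewrite ne' /=; apply/orP; right.
    apply: contrapT => /negP H; apply: adj; exists c; split=> //.
    by apply: (linear_total lin _ _ _ H) => //; [case: (linear_cands lin Hbc) | rewrite eq_sym].
  + subst b c; rewrite eqxx andbT in nab; rewrite (negPf ne) andbF /= eqxx andbT.
    apply/orP; right; apply: contrapT => /negP H; apply: adj; exists a; split=> //.
    by apply: (linear_total lin _ _ _ H) => //; case: (linear_cands lin Hab).
  + rewrite (tr _ _ _ Hab Hbc) andbT; apply/orP; right; apply/negP => /andP[/eqP Ea /eqP Ec].
    by apply: adj; exists b; rewrite -Ea -Ec.
move=> a b Ha Hb nab; rewrite !mem_do_swap /= !xpair_eqE.
have := tot a b Ha Hb nab.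
case: (boolP ((a == x) && (b == y))) => [/andP[/eqP -> /eqP ->]|_].
  by rewrite !eqxx /= !orbT.
case: (boolP ((b == x) && (a == y))) => [/andP[/eqP -> /eqP ->]|_].
  by rewrite !eqxx.
by rewrite /= => /orP[] ->; rewrite ?orbT.
Qed.

Lemma swaps_keep C (r : Defs.order) v ss : strict_linear_order C v -> r `<=` v ->
  swaps_allowed v ss -> {in ss, forall s, s \notin r} ->
  strict_linear_order C (do_swaps v ss) /\ r `<=` do_swaps v ss.
Proof.
elim: ss v => [|s ss IH] v //= lin sub [Hs Hss] Hr; apply: IH => //.
- exact: do_swap_linear.
- apply/fsubsetP => e He; rewrite mem_do_swap (fsubsetP sub _ He) andbT.
  apply/orP; right; apply: contraTneq He => ->; apply: Hr; exact: mem_head.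
- by move=> s' Hs'; apply: Hr; rewrite inE Hs' orbT.
Qed.

Definition between (v : Defs.order) (C : {fset nat}) a b : {fset nat} :=
  [fset c in C | ((a, c) \in v) && ((c, b) \in v)].

(** If [c] lies between [a] and [b] in [v], then [(a, c)] or [(c, b)] is also inverted, for
    otherwise transitivity of [w] would give [(a, b)]. The inverted pair then has fewer candidates
    in between, so the descent ends at an adjacent one. *)
Lemma adjacent_inversion C v w : strict_linear_order C v -> strict_linear_order C w ->
  forall n a b, #|` between v C a b| <= n -> (a, b) \in v -> (a, b) \notin w ->
  exists2 s, swap_allowed v s & s \notin w.
Proof.
move=> linv linw; have [[_ irr tr] _] := linv; have [[_ _ trw] _] := linw.
have memb c a b : (c \in between v C a b) = ((a, c) \in v) && ((c, b) \in v).
  rewrite !inE /= andb_idl // => /andP[H _]; by case: (linear_cands linv H).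
elim=> [|n IH] a b Hn Hab Hw;
  case: (pselect (exists c, (a, c) \in v /\ (c, b) \in v)) => [[c [Hac Hcb]]|adj];
  try by exists (a, b).
  by move: Hn; rewrite leqn0 cardfs_eq0 => /eqP E; have := memb c a b; rewrite E Hac Hcb inE.
have Hc : c \in between v C a b by rewrite memb Hac Hcb.
case: (boolP ((a, c) \in w)) => Haw.
  have Hcw : (c, b) \notin w by apply: contra Hw; apply: trw Haw.
  apply: (IH c b) => //; rewrite -ltnS; apply: leq_trans Hn; apply: (ltn_card_fset (x := c)) => //.
    by move=> x; rewrite !memb => /andP[H ->]; rewrite (tr _ _ _ Hac H).
  by rewrite memb (negPf (irr c)).
apply: (IH a c) => //; rewrite -ltnS; apply: leq_trans Hn; apply: (ltn_card_fset (x := c)) => //.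
  by move=> x; rewrite !memb => /andP[-> H]; rewrite (tr _ _ _ H Hcb).
by rewrite memb (negPf (irr c)) andbF.
Qed.

Lemma linear_sub_eq C v w : strict_linear_order C v -> strict_linear_order C w ->
  v `<=` w -> v = w.
Proof.
move=> linv linw sub; apply/fsetP => -[a b]; apply/idP/idP => [/(fsubsetP sub)//|H].
apply: contrapT => /negP Hv; have [Ha Hb] := linear_cands linw H.
have ne : a != b by apply: contraTneq H => ->; case: linw => -[].
have /(fsubsetP sub) Hba := linear_total linv Ha Hb ne Hv.
by have := linear_asym linw H; rewrite Hba.
Qed.

(* Bubble sort: as long as the current vote differs from the target, some adjacent
   pair is inverted, and swapping it lowers the number of inversions. *)
Lemma bubble_sort C (r v w : Defs.order) : strict_linear_order C v -> strict_linear_order C w ->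
  r `<=` v -> r `<=` w ->
  exists ss, [/\ swaps_allowed v ss, do_swaps v ss = w &
    {in ss, forall s, (s \notin r) && ((s.2, s.1) \notin r)}].
Proof.
move=> linv linw; move: {2}(#|` v `\` w|) (leqnn #|` v `\` w|) => n.
elim: n v linv => [|n IH] v linv Hn rv rw.
  exists [::]; split=> //; apply: linear_sub_eq linv linw _.
  by rewrite -fsetD_eq0 -cardfs_eq0 -leqn0.
case: (fset_0Vmem (v `\` w)) => [E|[[a b]]].
  exists [::]; split=> //; apply: linear_sub_eq linv linw _.
  by rewrite -fsetD_eq0 E.
rewrite inE => /andP[Hw Hv].
have [[x y] Hs Hsw] := adjacent_inversion linv linw (leqnn _) Hv Hw.
have [/= Hxy _] := Hs; have [Hx Hy] := linear_cands linv Hxy.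
have ne : x != y by apply: contraTneq Hxy => ->; case: linv => -[].
have Hyx := linear_total linw Hx Hy ne Hsw.
have Hr1 : (x, y) \notin r by apply: contra Hsw; apply: (fsubsetP rw).
have Hr2 : (y, x) \notin r.
  by apply: contra (linear_asym linv Hxy); apply: (fsubsetP rv).
have [|||| ss [H1 H2 H3]] := IH (do_swap v (x, y)).
- exact: do_swap_linear.
- rewrite -ltnS; apply: leq_trans Hn; apply: (ltn_card_fset (x := (x, y))).
  + move=> e; rewrite !in_fsetD mem_do_swap => /andP[He /orP[/eqP E|/andP[_ ->]]]; last by rewrite He.
    by rewrite E Hyx in He.
  + by rewrite in_fsetD Hsw.
  by rewrite in_fsetD mem_do_swap /= eqxx /= orbF xpair_eqE (negPf ne) andbF.
- have [] := @swaps_keep C r v [:: (x, y)] linv rv => //.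
  by move=> s; rewrite inE => /eqP ->.
- exact: rw.
exists ((x, y) :: ss); split=> //= s; rewrite inE => /orP[/eqP -> /=|/H3 //].
by rewrite Hr1 Hr2.
Qed.

(** * Bribery of cost zero and possible winners *)

Lemma touches_fset (r : seq npair) s :
  ~~ touches r s = (s \notin [fset e in r]) && ((s.2, s.1) \notin [fset e in r]).
Proof. by rewrite /touches !inE negb_or. Qed.

Lemma cheap_cost (O : seq (seq npair)) (B : bribery) :
  (\sum_(e <- zip [seq unit_cost r | r <- O] B) swaps_cost e.1 e.2 == 0) = cheap O B.
Proof.
elim: O B => [|r O IH] [|ss B]; rewrite /cheap /= ?big_nil //.
rewrite big_cons addn_eq0 IH; congr (_ && _) => /=; rewrite /swaps_cost.
elim: ss => [|[a b] ss IHs]; rewrite ?big_nil // big_cons addn_eq0 IHs unit_costE /=.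
by case: touches.
Qed.

Definition nth_ok (C : seq nat) (O : seq (seq npair)) (V : seq Defs.order) : Prop :=
  forall i, i < size V -> strict_linear_order [fset c in C] (nth fset0 V i) /\
     nth fset0 [seq [fset e in r] | r <- O] i `<=` nth fset0 V i.

Lemma bribery_exists C (O : seq (seq npair)) (V : seq Defs.order) : uniq C -> all (poset_on C) O ->
  size V = size O -> nth_ok C O V ->
  exists B : bribery, [/\ size B = size O,
    forall i, i < size O -> swaps_allowed (nth fset0 [seq lin_order C r | r <- O] i) (nth [::] B i),
    [seq do_swaps e.1 e.2 | e <- zip [seq lin_order C r | r <- O] B] = V & cheap O B].
Proof.
move=> uC; elim: O V => [|r O IH] [|v V] //=.
  by exists [::].
move=> /andP[Hr HO] [sV] H.
have [|B [B1 B2 B3 B4]] := IH V HO sV; first by move=> i Hi; apply: (H i.+1).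
have /= [linv rv] := H 0 isT.
have [ss [S1 S2 S3]] := bubble_sort (lin_order_linear C r) linv (lin_order_extends uC Hr) rv.
exists (ss :: B); split=> /=; [by rewrite B1 | by case | by rewrite S2 B3 | ].
rewrite /cheap /= -/(cheap O B) B4 andbT; apply/allP => s /S3.
by rewrite touches_fset.
Qed.

Lemma bribery_sound C (O : seq (seq npair)) (B : bribery) : uniq C -> all (poset_on C) O ->
  size B = size O ->
  (forall i, i < size O -> swaps_allowed (nth fset0 [seq lin_order C r | r <- O] i) (nth [::] B i)) ->
  cheap O B ->
  nth_ok C O [seq do_swaps e.1 e.2 | e <- zip [seq lin_order C r | r <- O] B].
Proof.
move=> uC; elim: O B => [|r O IH] [|ss B] //= /andP[Hr HO] [sB] H.
rewrite /cheap /= => /andP[/allP Hss HB].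
case=> [|i] /= Hi; last first.
  by apply: IH => // j Hj; apply: (H j.+1).
apply: swaps_keep (lin_order_linear C r) (lin_order_extends uC Hr) (H 0 isT) _.
by move=> s /Hss; rewrite touches_fset => /andP[].
Qed.

Section Reduction.
Variables (R : voting_rule) (d : pw_data).
Hypothesis Hd : valid_data d.

Lemma valid_data_uniq : uniq d.1.
Proof.
by have /and3P[] := Hd; rewrite sorted_zip => /(sorted_uniq ltn_trans ltnn).
Qed.

Lemma valid_data_posets : all (poset_on d.1) d.2.1.
Proof. by have /and3P[] := Hd. Qed.

Lemma possible_winner_bribery : is_possible_winner R (pw_of d) ->
  exists2 B, successful R (sb_of d) B & total_cost (sb_of d) B = 0.
Proof.
move=> [V [/= sV HV winV]]; rewrite size_map in sV.
have [B [B1 B2 B3 B4]] := bribery_exists valid_data_uniq valid_data_posets sV HV.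
exists B; last by apply/eqP; rewrite /total_cost /= cheap_cost.
by split; rewrite /= ?size_map // /bribed /= B3.
Qed.

Lemma bribery_possible_winner B : successful R (sb_of d) B -> cheap d.2.1 B ->
  is_possible_winner R (pw_of d).
Proof.
move=> [/= sB HB win] chB; rewrite size_map in sB HB.
have H := bribery_sound valid_data_uniq valid_data_posets sB HB chB.
exists (voters (bribed (sb_election (sb_of d)) B)); split=> //=.
by rewrite size_map size_zip !size_map sB minnn.
Qed.

End Reduction.

Lemma parse_answer B : parse_npairss (enc_seq (enc_seq enc_npair) B) = (B, [::]).
Proof. by have := parse_npairssK B [::]; rewrite cats0. Qed.

Lemma check_answerE u ans : check_answer (enc_string u ++ enc_answer ans) =
  valid u && (if ans is Some B then cheap (parse_data u).2.1 B else false).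
Proof.
rewrite /check_answer parse_stringK; case: ans => [B|]; last by [].
congr (_ && _).
change (cheap (parse_data u).2.1 (parse_npairss (enc_seq (enc_seq enc_npair) B)).1 =
  cheap (parse_data u).2.1 B).
by rewrite parse_answer.
Qed.

Lemma check_answerP (T : realType) (K : T) R u d ans :
  valid_data d -> (valid u -> d = parse_data u) ->
  approximate_answer K R (sb_of d) ans ->
  possible_winner R u <-> check_answer (enc_string u ++ enc_answer ans).
Proof.
move=> Hd Ed Hans; rewrite possible_winnerP check_answerE.
case: (boolP (valid u)) => Hu; last by split=> [[]|].
rewrite -(Ed Hu); split=> [[_ Hw]|].
  have [B0 succ0 cost0] := possible_winner_bribery Hd Hw.
  case: ans Hans => [B|] /= Hans; last by case: Hans; exists B0.
  case: Hans => succB [m [_ Hmin] Hm].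
  (* The free bribery [B0] pins the optimum to 0, so the bound [K * m] vanishes for every factor;
     the same [B0] has already refuted the answer [None]. *)
  have m0 : m = 0 by apply/eqP; rewrite -leqn0 -cost0 Hmin.
  move: Hm; rewrite m0 GRing.mulr0 Num.Theory.lern0.
  by rewrite /total_cost /= cheap_cost.
case: ans Hans => [B [succB _]|] //= chB.
by split=> //; apply: bribery_possible_winner succB chB.
Qed.

(** * Deciding every language in NP *)

Lemma polytime_compose f g : polytime f -> polytime g -> polytime (fun x => g (f x)).
Proof.
move=> Hf /polytimeP[M [k Hk]]; apply: (polytime_comp (M := M) Hf).
by exists k => x; apply: Hk.
Qed.

(** [P_eq_NP] is an equivalence, so the easy inclusion is due as well. The empty certificate
    suffices, hence the zero polynomial as its length bound. *)
Lemma inP_inNP L : inP L -> inNP L.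
Proof.
move=> [f [Pf Hf]]; exists (fun z => L (parse_string z).1), 0%R; split.
  exists (fun z => f (parse_string z).1); split; last by move=> z; apply: Hf.
  have H : polytime (fun z => (parse_string z).1).
    by apply: tpt_polytime; apply: tpt_fst_of; apply: tpt_parse_string.
  exact: polytime_compose H Pf.
move=> x; cbv beta.
have E w : (parse_string (enc_pair enc_string enc_string (x, w))).1 = x.
  by rewrite /enc_pair parse_stringK.
split=> [Lx|[w [_]]]; last by rewrite E.
by exists [::]; rewrite E.
Qed.

Theorem mainTheorem5 (T : realType) (R : voting_rule) :
  NP_hard (possible_winner R) ->
  ~ P_eq_NP ->
  forall K : T, (0 < K)%R -> ~ exists M : TM, polytime_approximation K R M.
Proof.
move=> hard PNP K _ [M [p HM]]; apply: PNP => L; split; first exact: inP_inNP.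
move=> /hard [f [Pf Hf]].
have HG u : exists y, (exists2 t, t <= (p.[size (to_bribery u)])%R & tm_outputs M (to_bribery u) t y) /\
    (possible_winner R u <-> check_answer (enc_string u ++ y)).
  have [d Hd [Eu Ed]] := to_bribery_enc u.
  have [t [y [Ht Hy [ans Ey Hans]]]] := HM _ (sb_of_wf Hd).
  exists y; split; first by exists t; rewrite Eu.
  by rewrite Ey; apply: check_answerP Hd Ed Hans.
(* Answers are specified by a relation, so a function [G] has to be chosen. Each chosen answer comes
   with a run of [M] on [to_bribery u], and therefore [M] after the reduction computes [G]. *)
have [G HGu] := choice HG.
have PG : polytime G.
  apply: (polytime_comp (M := M) (tpt_polytime tpt_to_bribery)).
  have [k Hk] := poly_PB p; exists k => u; have [[t Ht Hy] _] := HGu u.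
  by exists t => //; apply: leq_trans Ht (Hk _).
exists (fun x => check_answer (enc_string (f x) ++ G (f x))); split.
  have Pc : polytime (fun v => [:: check_answer v]).
    by apply: tpt_polytime; apply: tpt_cons tpt_check_answer (tpt_const _).
  exact: polytime_compose (polytime_compose Pf (polytime_keep PG)) Pc.
by move=> x; rewrite Hf; apply: (HGu (f x)).2.
Qed.
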